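(* The well-definedness problem for the language $\mathrm{PERX}^-[\mathrm{empty}]$ (and thus also for the language RX) is undecidable: for every choice of the computable oracle functions $\mathit{content}$ and $\mathit{concat}$, there is no algorithm which, given a $\mathrm{PERX}^-[\mathrm{empty}]$ expression (respectively an RX expression) $e$ and an assignment $\Gamma$ of RX-types to the free variables of $e$, decides whether $e(\sigma)$ is defined for every environment $\sigma\in\Gamma$.
   Context: **Values.** $\mathcal A$ is an infinite recursively enumerable set of atoms. Nodes are defined inductively: a node is an element node $\langle a:N\rangle$ or a data node $\langle a\rangle$, where $a\in\mathcal A$ and $N$ is a finite set of nodes. An item is an atom or a node. An RX-value is a finite set of items. **Types.** RX-types $\tau$ are generated by $\tau::=\mathbf{coll}(\iota)\mid\mathbf{single}(\iota)$; $\iota::=\mathbf{atom}\mid\nu\mid\iota\cup\iota$; $\nu::=\mathbf{data}\mid\mathbf{elem}(\gamma)\mid\nu\cup\nu$; $\gamma::=\mathbf{coll}(\nu)\mid\mathbf{single}(\nu)$. Denotations: $\mathbf{atom}$ is $\mathcal A$; $\mathbf{data}$ is the set of all data nodes; $\mathbf{elem}(\gamma)$ is the set of all $\langle a:N\rangle$ with $N$ in the denotation of $\gamma$; $\cup$ is union; $\mathbf{coll}(\iota)$ is the set of all finite subsets of the denotation of $\iota$; $\mathbf{single}(\iota)$ is the set of all singleton subsets of the denotation of $\iota$. Types are identified with their denotations. **Kinds.** RX-kinds are generated by $\kappa::=\mathbf{atom}\mid\mathbf{data}\mid\mathbf{elem}\mid\kappa\cup\kappa$, denoting the set of all atoms,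 all data nodes, all element nodes, and unions. **Expressions.** RX expressions are generated by $$e::=x\mid text\{e\}\mid elem\{e\}\{e\}\mid data(e)\mid name(e)\mid children(e)\mid()\mid e,e\mid for\ x:\kappa\ in\ e\ return\ e$$ $$\mid if\ e\ eq\ e\ then\ e\ else\ e\mid if\ e=\emptyset\ then\ e\ else\ e\mid if\ e\in\tau\ then\ e\ else\ e,$$ where $x$ ranges over an infinite set of variables, $\kappa$ over RX-kinds, $\tau$ over RX-types. In ''$for\ x:\kappa\ in\ e_1\ return\ e_2$'' the variable $x$ is bound in $e_2$; $FV(e)$ is the set of free variables of $e$. $\mathrm{PERX}^-[\mathrm{empty}]$ is the fragment without $text\{e\}$, without $data(e)$, without type switches ($if\ e_1\in\tau\ldots$), and in which the only kind used is $\mathbf{atom}\cup\mathbf{data}\cup\mathbf{elem}$ (emptiness tests are allowed). **Semantics.** Fix computable oracle functions $\mathit{content}$ (element nodes to atoms) and $\mathit{concat}$ (finite sets of atoms to atoms). For values $v,w$: $data(v)=\{a\mid a\in v \text{ an atom}\}\cup\{a\mid\langle a\rangle\in v\}\cup\{\mathit{content}(\langle a:N\rangle)\mid\langle a:N\rangle\in v\}$; $name(v)=\{a\}$ if $v=\{\langle a:N\rangle\}$, $name(\emptyset)=\{\mathit{concat}(\emptyset)\}$, undefined otherwise; $children(v)$ is undefined if $v$ contains an atom, and otherwise is $\bigcup\{N\mid\langle a:N\rangle\in v\}$; $construct(v,w)$ is undefined if $data(v)$ is not a singleton $\{a\}$, and otherwise is $\langle a:N\rangle$ with $N=\{\langle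 b\rangle\mid b\in w\text{ an atom}\}\cup\{i\in w\mid i\text{ a node}\}$. An environment $\sigma$ on $e$ maps each $x\in FV(e)$ to an RX-value; $x:v,\sigma$ denotes $\sigma$ updated to send $x$ to $v$. The partial semantics is: $x(\sigma)=\sigma(x)$; $text\{e\}(\sigma)=\{\langle\mathit{concat}(data(e(\sigma)))\rangle\}$; $elem\{e_1\}\{e_2\}(\sigma)=\{construct(e_1(\sigma),e_2(\sigma))\}$; $data(e)(\sigma)=data(e(\sigma))$; $name(e)(\sigma)=name(e(\sigma))$; $children(e)(\sigma)=children(e(\sigma))$; $()(\sigma)=\emptyset$; $(e_1,e_2)(\sigma)=e_1(\sigma)\cup e_2(\sigma)$; $(for\ x:\kappa\ in\ e_1\ return\ e_2)(\sigma)=\bigcup\{e_2(x:\{i\},\sigma)\mid i\in e_1(\sigma)\cap\kappa\}$; $(if\ e_1\ eq\ e_2\ then\ e_3\ else\ e_4)(\sigma)$ is $e_3(\sigma)$ if $data(e_1(\sigma))=data(e_2(\sigma))=\{a\}$ for an atom $a$, is $e_4(\sigma)$ if $data(e_1(\sigma))=\{a\}$ and $data(e_2(\sigma))=\{b\}$ for atoms $a\ne b$, and is undefined otherwise; $(if\ e_1=\emptyset\ then\ e_2\ else\ e_3)(\sigma)$ is $e_2(\sigma)$ if $e_1(\sigma)=\emptyset$ and $e_3(\sigma)$ otherwise; $(if\ e_1\in\tau\ then\ e_2\ else\ e_3)(\sigma)$ is $e_2(\sigma)$ if $e_1(\sigma)\in\tau$ and $e_3(\sigma)$ otherwise. An expression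 is undefined whenever a value it refers to in its defining clause is undefined (branches not taken are not evaluated). **Type assignments.** A type assignment $\Gamma$ on $e$ maps each $x\in FV(e)$ to an RX-type. $\sigma\in\Gamma$ means that $\sigma$ and $\Gamma$ have the same domain and $\sigma(x)\in\Gamma(x)$ for all $x$. *)

(* Defs.v *)
From HB Require Import structures.
From mathcomp Require Import all_boot finmap.

Set Implicit Arguments.
Unset Strict Implicit.
Unset Printing Implicit Defensive.

Local Open Scope fset_scope.
Local Open Scope nat_scope.

(* Kleene's mu-recursive functions, arities not being tracked: a function reads
   its arguments from a list, a
   missing argument of [MuSucc] or [MuProj] being read as 0. *)
Inductive murec : Type :=
| MuZero
| MuSucc
| MuProj of nat
| MuComp of murec & seq murec
| MuPrec of murec & murec
| MuMin of murec.

(* [mu_eval f s r]: the partial function denoted by [f] is defined at [s], with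
   value [r]. *)
Inductive mu_eval : murec -> seq nat -> nat -> Prop :=
| EvZero s : mu_eval MuZero s 0
| EvSucc s : mu_eval MuSucc s (nth 0 s 0).+1
| EvProj i s : mu_eval (MuProj i) s (nth 0 s i)
| EvComp f gs s vs r :
    size vs = size gs ->
    (forall i, i < size gs -> mu_eval (nth MuZero gs i) s (nth 0 vs i)) ->
    mu_eval f vs r ->
    mu_eval (MuComp f gs) s r
| EvPrec0 f g s r : mu_eval f s r -> mu_eval (MuPrec f g) (0 :: s) r
| EvPrecS f g n s r r' :
    mu_eval (MuPrec f g) (n :: s) r ->
    mu_eval g [:: n, r & s] r' ->
    mu_eval (MuPrec f g) (n.+1 :: s) r'
| EvMin f s n (w : nat -> nat) :
    (forall i, i < n -> mu_eval f (i :: s) (w i).+1) ->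
    mu_eval f (n :: s) 0 ->
    mu_eval (MuMin f) s n.

Lemma mu_eval_det f s r1 r2 : mu_eval f s r1 -> mu_eval f s r2 -> r1 = r2.
Proof.
move=> H; elim: H r2 => {f s r1}.
- by move=> s r2 H; inversion H.
- by move=> s r2 H; inversion H.
- by move=> i s r2 H; inversion H.
- move=> f gs s vs r sz _ IHg _ IHf r2 H.
  inversion H as [| | |f' gs' s' vs' r' sz' Hg' Hf'| | |]; subst.
  apply: IHf; suff -> : vs = vs' by [].
  apply: (@eq_from_nth _ 0); first by rewrite sz sz'.
  by move=> i; rewrite sz => lti; apply: IHg => //; apply: Hg'.
- by move=> f g s r _ IH r2 H; inversion H; apply: IH.
- move=> f g n s r r' _ IH1 _ IH2 r2 H.
  inversion H as [| | | | |f0 g0 n0 s0 r0 r0' H1 H2|]; subst.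
  by apply: IH2; rewrite (IH1 _ H1).
- move=> f s n w _ IHw _ IH0 r2 H.
  inversion H as [| | | | | |f0 s0 n0 w0 Hw0 H0]; subst.
  case: (ltngtP n r2) => // [lt|lt].
  + by have := IH0 _ (Hw0 _ lt).
  + by have := IHw _ lt _ H0.
Qed.

Definition recursively_enumerable (S : nat -> Prop) : Prop :=
  exists f : murec, forall n, S n <-> exists r, mu_eval f [:: n] r.

(* The decision problem "given x such that D x, does Q x hold?": the answer is
   computed from the code of [x] as 1 or 0, with no requirement on the behaviour
   of the algorithm on numbers that do not encode an admissible input. *)
Definition decidable_on (T : Type) (code : T -> nat) (D Q : T -> Prop) : Prop :=
  exists f : murec, forall x, D x ->
    (Q x -> mu_eval f [:: code x] 1) /\ (~ Q x -> mu_eval f [:: code x] 0).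

(* Cantor's pairing (x + y)(x + y + 1) / 2 + y. *)
Definition cpair (x y : nat) : nat := 'C((x + y).+1, 2) + y.

Lemma cpair_inj x y x' y' : cpair x y = cpair x' y' -> x = x' /\ y = y'.
Proof.
have tri n : 'C(n.+2, 2) = 'C(n.+1, 2) + n.+1 by rewrite binS bin1.
have mono m n : m <= n -> 'C(m.+1, 2) <= 'C(n.+1, 2).
  move=> le_mn; rewrite -(subnK le_mn); elim: (n - m) => // k IH.
  by rewrite addSn tri (leq_trans IH) ?leq_addr.
have lt u v u' v' : u + v < u' + v' -> cpair u v < cpair u' v'.
  move=> /mono le1; rewrite /cpair (leq_trans _ (leq_addr _ _)) //.
  by rewrite (leq_trans _ le1) // tri ltn_add2l ltnS leq_addl.
case: (ltngtP (x + y) (x' + y')) => [/lt|/lt|E] => [||].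
- by move=> + eqc; rewrite eqc ltnn.
- by move=> + eqc; rewrite eqc ltnn.
- rewrite /cpair E => /addnI Ey; split=> //.
  by move: E; rewrite Ey => /addIn.
Qed.

Definition code_seq (s : seq nat) : nat := foldr (fun x c => (cpair x c).+1) 0 s.

Lemma code_seq_inj : injective code_seq.
Proof.
by elim=> [|x s IH] [|y t] //= [] /cpair_inj[-> /IH ->].
Qed.

(* The atoms form an arbitrary countable type, identified with a set of natural
   numbers by its canonical injection into [nat]. *)
Definition atom_code (atom : countType) (a : atom) : nat := choice.pickle a.

Section Values.

Variable atom : countType.

(* Nodes carry finite sets of nodes.  They are represented by finitely branching
   trees in which the list of subtrees of each element node is strictly
   increasing for the order of codes. *)
Inductive tree : Type :=
| TData of atom
| TElem of atom & seq tree.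

Fixpoint code_tree (t : tree) : nat :=
  match t with
  | TData a => cpair 0 (atom_code a)
  | TElem a ts => cpair 1 (cpair (atom_code a) (code_seq (map code_tree ts)))
  end.

Lemma tree_ind' (P : tree -> Prop) :
  (forall a, P (TData a)) ->
  (forall a ts, (forall i, i < size ts -> P (nth (TData a) ts i)) ->
     P (TElem a ts)) ->
  forall t, P t.
Proof.
move=> PD PE; fix F 1 => -[a|a ts]; first exact: PD.
apply: PE; elim: ts => [|t ts IH] i; first by rewrite ltn0; discriminate.
case: i => [_|i]; [exact: F | exact: IH].
Qed.

Fixpoint gentree_of_tree (t : tree) : GenTree.tree atom :=
  match t with
  | TData a => GenTree.Leaf a
  | TElem a ts => GenTree.Node 0 (GenTree.Leaf a :: map gentree_of_tree ts)
  end.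

Fixpoint tree_of_gentree (t : GenTree.tree atom) : option tree :=
  match t with
  | GenTree.Leaf a => Some (TData a)
  | GenTree.Node _ (GenTree.Leaf a :: ts) =>
      Some (TElem a (pmap tree_of_gentree ts))
  | GenTree.Node _ _ => None
  end.

Lemma gentree_of_treeK : pcancel gentree_of_tree tree_of_gentree.
Proof.
elim/tree_ind'=> //= a ts IH; congr (Some (TElem _ _)).
elim: ts IH => //= t ts IH Hts.
rewrite (Hts 0 isT) /= IH // => i lti; exact: (Hts i.+1 lti).
Qed.

HB.instance Definition _ := Countable.copy tree (pcan_type gentree_of_treeK).

Lemma code_tree_inj : injective code_tree.
Proof.
have pkI : injective (@atom_code atom) := pcan_inj choice.pickleK.
elim/tree_ind'=> [a|a ts IH] [b|b us] /= /cpair_inj[] // _.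
  by move/pkI->.
move=> /cpair_inj[/pkI <- /code_seq_inj E]; congr TElem.
elim: ts us IH E => [|t ts IHts] [|u us] //= IH [Etu E].
have <- : t = u := IH 0 isT u Etu.
by rewrite (IHts us) // => i lti; exact: (IH i.+1 lti).
Qed.

Fixpoint canonical_tree (t : tree) : bool :=
  match t with
  | TData _ => true
  | TElem _ ts => sorted ltn (map code_tree ts) && all canonical_tree ts
  end.

Record node : Type := Node { tree_of :> tree; _ : canonical_tree tree_of }.

HB.instance Definition _ := [isSub for tree_of].
HB.instance Definition _ := [Countable of node by <:].

Definition code_node (n : node) : nat := code_tree n.

Lemma code_node_inj : injective code_node.
Proof. exact: (inj_comp code_tree_inj val_inj). Qed.

Definition data_node (a : atom) : node := @Node (TData a) isT.

Definition subtrees (N : {fset node}) : seq tree :=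
  map val (sort (relpre code_node leq) N).

Lemma elem_node_subproof a (N : {fset node}) :
  canonical_tree (TElem a (subtrees N)).
Proof.
rewrite /= ltn_sorted_uniq_leq -map_comp (map_inj_uniq code_node_inj).
rewrite sort_uniq fset_uniq sorted_map sort_sorted => [|x y]; last exact: leq_total.
by apply/allP=> _ /mapP[[t ct] _ ->].
Qed.

Definition elem_node (a : atom) (N : {fset node}) : node :=
  Node (elem_node_subproof a N).

Definition is_elem (n : node) : bool :=
  if tree_of n is TElem _ _ then true else false.

Definition node_label (n : node) : atom :=
  match tree_of n with TData a => a | TElem a _ => a end.

Definition node_children (n : node) : {fset node} :=
  match tree_of n with
  | TData _ => fset0
  | TElem _ ts => [fset n : node in pmap insub ts]
  end.

Lemma is_elem_elem a N : is_elem (elem_node a N).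
Proof. by []. Qed.

Lemma node_label_elem a N : node_label (elem_node a N) = a.
Proof. by []. Qed.

Lemma node_children_elem a N : node_children (elem_node a N) = N.
Proof.
apply/fsetP=> n; rewrite !inE /= /subtrees map_pK ?mem_sort //; exact: valK.
Qed.

Lemma elem_node_inj a b N M : elem_node a N = elem_node b M -> a = b /\ N = M.
Proof.
move=> E; split; first by rewrite -(node_label_elem a N) E.
by rewrite -(node_children_elem a N) E node_children_elem.
Qed.

Lemma elem_nodeK n : is_elem n -> elem_node (node_label n) (node_children n) = n.
Proof.
case: n => -[a|a ts] //= cts _; apply: val_inj => /=; congr TElem.
rewrite /node_children /subtrees /=.
case/andP: (cts); rewrite ltn_sorted_uniq_leq => /andP[uts sts] /allP ats.
set us : seq node := pmap insub ts.
have Eus : map val us = ts.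
  rewrite /us (pmap_filter (@insubK _ _ _)); apply/all_filterP/allP=> t /ats.
  by rewrite isSome_insub.
rewrite -[RHS]Eus; congr map.
apply: (@sorted_eq _ (relpre code_node leq)).
- by move=> x y z; apply: leq_trans.
- by move=> x y H; apply: code_node_inj; apply/anti_leq.
- by apply: sort_sorted => x y; apply: leq_total.
- by rewrite -sorted_map [map _ us](map_comp code_tree val) Eus.
rewrite perm_sort; apply: uniq_perm; first exact: fset_uniq.
  by apply: (@map_uniq _ _ code_node); rewrite [map _ us](map_comp code_tree val) Eus.
by move=> x; rewrite !inE.
Qed.

Lemma node_ind (P : node -> Prop) :
  (forall a, P (data_node a)) ->
  (forall a N, (forall n, n \in N -> P n) -> P (elem_node a N)) ->
  forall n, P n.
Proof.
move=> PD PE [t ct]; elim/tree_ind': t ct => [a|a ts IH] ct.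
  by rewrite (_ : Node ct = data_node a) //; apply: val_inj.
rewrite -[Node ct]elem_nodeK //; apply: PE => n.
rewrite /node_children !inE /= mem_pmap => /mapP[t tin].
case: insubP => // u _ Eu [->]; case: u Eu => u cu /= Eu.
case/(nthP (TData a)): tin => i lti Ei; move: cu; rewrite Eu -Ei => cu.
exact: IH.
Qed.

Definition item : Type := (atom + node)%type.
Definition value : Type := {fset item}.

End Values.

Arguments data_node {atom} a.
Arguments elem_node {atom} a N.

Inductive ntype : Type :=
| NData
| NElem of gtype
| NUnion of ntype & ntype
with gtype : Type :=
| GColl of ntype
| GSingle of ntype.

Inductive itype : Type :=
| IAtom
| INode of ntype
| IUnion of itype & itype.

Inductive rxtype : Type :=
| RColl of itype
| RSingle of itype.

Inductive kind : Type :=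
| KAtom
| KData
| KElem
| KUnion of kind & kind.

Section Denotations.

Variable atom : countType.

Fixpoint in_ntype (t : ntype) (n : node atom) : bool :=
  match t with
  | NData => ~~ is_elem n
  | NElem g => is_elem n && in_gtype g (node_children n)
  | NUnion t1 t2 => in_ntype t1 n || in_ntype t2 n
  end
with in_gtype (g : gtype) (N : {fset node atom}) : bool :=
  match g with
  | GColl t => all (in_ntype t) N
  | GSingle t => (#|` N| == 1) && all (in_ntype t) N
  end.

Fixpoint in_itype (t : itype) (i : item atom) : bool :=
  match t with
  | IAtom => if i is inl _ then true else false
  | INode t' => if i is inr n then in_ntype t' n else false
  | IUnion t1 t2 => in_itype t1 i || in_itype t2 i
  end.

Definition in_rxtype (t : rxtype) (v : value atom) : bool :=
  match t with
  | RColl t' => all (in_itype t') v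
  | RSingle t' => (#|` v| == 1) && all (in_itype t') v
  end.

Fixpoint in_kind (k : kind) (i : item atom) : bool :=
  match k with
  | KAtom => if i is inl _ then true else false
  | KData => if i is inr n then ~~ is_elem n else false
  | KElem => if i is inr n then is_elem n else false
  | KUnion k1 k2 => in_kind k1 i || in_kind k2 i
  end.

End Denotations.

Definition var : Type := nat.

Inductive expr : Type :=
| Var of var
| Text of expr
| Elem of expr & expr
| Data of expr
| Name of expr
| Children of expr
| Empty
| Comma of expr & expr
| For of var & kind & expr & expr      (* for x : k in e1 return e2 *)
| IfEq of expr & expr & expr & expr    (* if e1 eq e2 then e3 else e4 *)
| IfEmpty of expr & expr & expr        (* if e1 = empty then e2 else e3 *)
| IfType of expr & rxtype & expr & expr. (* if e1 in t then e2 else e3 *)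

Fixpoint fv (e : expr) : {fset var} :=
  match e with
  | Var x => [fset x]
  | Text e1 | Data e1 | Name e1 | Children e1 => fv e1
  | Empty => fset0
  | Elem e1 e2 | Comma e1 e2 => fv e1 `|` fv e2
  | For x _ e1 e2 => fv e1 `|` (fv e2 `\ x)
  | IfEq e1 e2 e3 e4 => fv e1 `|` fv e2 `|` fv e3 `|` fv e4
  | IfEmpty e1 e2 e3 => fv e1 `|` fv e2 `|` fv e3
  | IfType e1 _ e2 e3 => fv e1 `|` fv e2 `|` fv e3
  end.

(* The kind atom | data | elem, with union read as left-associative. *)
Definition any_kind : kind := KUnion (KUnion KAtom KData) KElem.

Fixpoint perx_empty (e : expr) : Prop :=
  match e with
  | Var _ | Empty => True
  | Text _ | Data _ | IfType _ _ _ _ => False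
  | Name e1 | Children e1 => perx_empty e1
  | Elem e1 e2 | Comma e1 e2 => perx_empty e1 /\ perx_empty e2
  | For _ k e1 e2 => [/\ k = any_kind, perx_empty e1 & perx_empty e2]
  | IfEq e1 e2 e3 e4 =>
      [/\ perx_empty e1, perx_empty e2, perx_empty e3 & perx_empty e4]
  | IfEmpty e1 e2 e3 => [/\ perx_empty e1, perx_empty e2 & perx_empty e3]
  end.

Section Semantics.

Variable atom : countType.
Variable content : atom -> {fset node atom} -> atom. (* on element nodes <a:N> *)
Variable concat : {fset atom} -> atom.

Implicit Types (v w : value atom) (i : item atom).

(* [data v] collects exactly one atom from each item of [v]. *)
Definition item_data i : atom :=
  match i with
  | inl a => a
  | inr n => if is_elem n then content (node_label n) (node_children n)
             else node_label n
  end.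

Definition data v : {fset atom} := [fset item_data i | i in v].

Definition atom_value (a : atom) : value atom := [fset inl a].
Definition node_value (n : node atom) : value atom := [fset inr n].

Definition name v : option (value atom) :=
  match enum_fset v with
  | [::] => Some (atom_value (concat fset0))
  | [:: inr n] => if is_elem n then Some (atom_value (node_label n)) else None
  | _ => None
  end.

Definition item_children i : value atom :=
  match i with
  | inl _ => fset0
  | inr n => [fset inr m | m in node_children n]
  end.

Definition children v : option (value atom) :=
  if has (in_kind KAtom) v then None
  else Some (\bigcup_(i <- v) item_children i).

Definition item_node i : node atom :=
  match i with
  | inl b => data_node b
  | inr n => n
  end.

Definition construct v w : option (node atom) :=
  if enum_fset (data v) is [:: a]
  then Some (elem_node a [fset item_node i | i in w]) else None.

Definition env : Type := {fmap var -> value atom}.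

(* [None] stands for "undefined". *)
Fixpoint eval (s : env) (e : expr) : option (value atom) :=
  match e with
  | Var x => s.[? x]%fmap
  | Text e1 =>
      if eval s e1 is Some v then Some (node_value (data_node (concat (data v))))
      else None
  | Elem e1 e2 =>
      match eval s e1, eval s e2 with
      | Some v, Some w => omap node_value (construct v w)
      | _, _ => None
      end
  | Data e1 =>
      if eval s e1 is Some v then Some [fset inl a | a in data v] else None
  | Name e1 => if eval s e1 is Some v then name v else None
  | Children e1 => if eval s e1 is Some v then children v else None
  | Empty => Some fset0
  | Comma e1 e2 =>
      match eval s e1, eval s e2 with
      | Some v, Some w => Some (v `|` w)
      | _, _ => None
      end
  | For x k e1 e2 =>
      if eval s e1 is Some v then
        let r i := eval s.[x <- [fset i]]%fmap e2 in
        if all (fun i => in_kind k i ==> isSome (r i)) v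
        then Some (\bigcup_(i <- v | in_kind k i) odflt fset0 (r i)) else None
      else None
  | IfEq e1 e2 e3 e4 =>
      match eval s e1, eval s e2 with
      | Some v, Some w =>
          match enum_fset (data v), enum_fset (data w) with
          | [:: a], [:: b] => if a == b then eval s e3 else eval s e4
          | _, _ => None
          end
      | _, _ => None
      end
  | IfEmpty e1 e2 e3 =>
      if eval s e1 is Some v then
        if v == fset0 then eval s e2 else eval s e3
      else None
  | IfType e1 t e2 e3 =>
      if eval s e1 is Some v then
        if in_rxtype t v then eval s e2 else eval s e3
      else None
  end.

Definition type_assignment : Type := {fmap var -> rxtype}.

Definition env_in (s : env) (G : type_assignment) : Prop :=
  domf s = domf G /\
  forall x v t, s.[? x]%fmap = Some v -> G.[? x]%fmap = Some t -> in_rxtype t v.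

Definition well_defined (p : expr * type_assignment) : Prop :=
  forall s : env, env_in s p.2 -> exists v, eval s p.1 = Some v.

(* A computable oracle: from the code of its argument, some mu-recursive
   function computes the code of its result.  The code of a finite set of atoms
   is that of the increasing list of the codes of its members. *)
Definition computable_content : Prop :=
  exists f : murec, forall a N,
    mu_eval f [:: code_node (elem_node a N)] (atom_code (content a N)).

Definition code_atoms (A : {fset atom}) : nat :=
  code_seq (sort leq [seq atom_code a | a <- A]).

Definition computable_concat : Prop :=
  exists f : murec, forall A, mu_eval f [:: code_atoms A] (atom_code (concat A)).

End Semantics.

Fixpoint code_ntype (t : ntype) : nat :=
  match t with
  | NData => cpair 0 0
  | NElem g => cpair 1 (code_gtype g)
  | NUnion t1 t2 => cpair 2 (cpair (code_ntype t1) (code_ntype t2))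
  end
with code_gtype (g : gtype) : nat :=
  match g with
  | GColl t => cpair 0 (code_ntype t)
  | GSingle t => cpair 1 (code_ntype t)
  end.

Fixpoint code_itype (t : itype) : nat :=
  match t with
  | IAtom => cpair 0 0
  | INode t' => cpair 1 (code_ntype t')
  | IUnion t1 t2 => cpair 2 (cpair (code_itype t1) (code_itype t2))
  end.

Definition code_rxtype (t : rxtype) : nat :=
  match t with
  | RColl t' => cpair 0 (code_itype t')
  | RSingle t' => cpair 1 (code_itype t')
  end.

Fixpoint code_kind (k : kind) : nat :=
  match k with
  | KAtom => cpair 0 0
  | KData => cpair 1 0
  | KElem => cpair 2 0
  | KUnion k1 k2 => cpair 3 (cpair (code_kind k1) (code_kind k2))
  end.

Fixpoint code_expr (e : expr) : nat :=
  match e with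
  | Var x => cpair 0 x
  | Text e1 => cpair 1 (code_expr e1)
  | Elem e1 e2 => cpair 2 (cpair (code_expr e1) (code_expr e2))
  | Data e1 => cpair 3 (code_expr e1)
  | Name e1 => cpair 4 (code_expr e1)
  | Children e1 => cpair 5 (code_expr e1)
  | Empty => cpair 6 0
  | Comma e1 e2 => cpair 7 (cpair (code_expr e1) (code_expr e2))
  | For x k e1 e2 =>
      cpair 8 (cpair (cpair x (code_kind k)) (cpair (code_expr e1) (code_expr e2)))
  | IfEq e1 e2 e3 e4 =>
      cpair 9 (cpair (cpair (code_expr e1) (code_expr e2))
                     (cpair (code_expr e3) (code_expr e4)))
  | IfEmpty e1 e2 e3 =>
      cpair 10 (cpair (code_expr e1) (cpair (code_expr e2) (code_expr e3)))
  | IfType e1 t e2 e3 =>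
      cpair 11 (cpair (cpair (code_expr e1) (code_rxtype t))
                      (cpair (code_expr e2) (code_expr e3)))
  end.

Definition code_binding (G : type_assignment) (x : var) : nat :=
  if G.[? x]%fmap is Some t then cpair x (code_rxtype t) else 0.

(* A type assignment is presented as the list of its bindings, by increasing
   variable. *)
Definition code_assignment (G : type_assignment) : nat :=
  code_seq [seq code_binding G x | x <- sort leq (domf G)].

Definition code_instance (p : expr * type_assignment) : nat :=
  cpair (code_expr p.1) (code_assignment p.2).

Scheme ntype_mut := Induction for ntype Sort Prop
with gtype_mut := Induction for gtype Sort Prop.

Lemma code_ntype_inj : injective code_ntype.
Proof.
apply: (@ntype_mut (fun t => forall u, code_ntype t = code_ntype u -> t = u)
  (fun g => forall h, code_gtype g = code_gtype h -> g = h)).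
- by case=> [|?|? ?] /= /cpair_inj[].
- by move=> g IH [|?|? ?] /= /cpair_inj[] // _ /IH ->.
- by move=> t1 IH1 t2 IH2 [|?|? ?] /= /cpair_inj[] // _ /cpair_inj[/IH1-> /IH2->].
- by move=> t IH [?|?] /= /cpair_inj[] // _ /IH ->.
- by move=> t IH [?|?] /= /cpair_inj[] // _ /IH ->.
Qed.

Lemma code_itype_inj : injective code_itype.
Proof.
elim=> [|t|t1 IH1 t2 IH2] [|?|? ?] /= /cpair_inj[] // _.
  by move/code_ntype_inj->.
by move=> /cpair_inj[/IH1-> /IH2->].
Qed.

Lemma code_rxtype_inj : injective code_rxtype.
Proof. by case=> t [u|u] /= /cpair_inj[] // _ /code_itype_inj ->. Qed.

Lemma code_kind_inj : injective code_kind.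
Proof.
elim=> [||| k1 IH1 k2 IH2] [|||? ?] /= /cpair_inj[] // _.
by move=> /cpair_inj[/IH1-> /IH2->].
Qed.

Lemma code_expr_inj : injective code_expr.
Proof.
elim=> [x|e1 H1|e1 H1 e2 H2|e1 H1|e1 H1|e1 H1||e1 H1 e2 H2|x k e1 H1 e2 H2
       |e1 H1 e2 H2 e3 H3 e4 H4|e1 H1 e2 H2 e3 H3|e1 H1 t e2 H2 e3 H3] [] /=;
  intros; match goal with E : cpair _ _ = _ |- _ => case/cpair_inj: E end => //.
- by move=> _ ->.
- by move=> _ /H1 ->.
- by move=> _ /cpair_inj[/H1-> /H2->].
- by move=> _ /H1 ->.
- by move=> _ /H1 ->.
- by move=> _ /H1 ->.
- by move=> _ /cpair_inj[/H1-> /H2->].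
- by move=> _ /cpair_inj[/cpair_inj[-> /code_kind_inj->] /cpair_inj[/H1-> /H2->]].
- by move=> _ /cpair_inj[/cpair_inj[/H1-> /H2->] /cpair_inj[/H3-> /H4->]].
- by move=> _ /cpair_inj[/H1-> /cpair_inj[/H2-> /H3->]].
- move=> _ /cpair_inj[/cpair_inj[/H1-> /code_rxtype_inj->]].
  by move=> /cpair_inj[/H2-> /H3->].
Qed.

Lemma code_assignment_inj : injective code_assignment.
Proof.
have bE (G : type_assignment) x t : reflect (G.[? x]%fmap = Some t)
    (cpair x (code_rxtype t) \in [seq code_binding G y | y <- sort leq (domf G)]).
  apply: (iffP mapP) => [[y]|E].
    rewrite mem_sort /code_binding; case: fndP => // yin _.
    by case/cpair_inj=> -> /code_rxtype_inj ->; rewrite in_fnd.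
  exists x; last by rewrite /code_binding E.
  by rewrite mem_sort; case: fndP E.
move=> G H /code_seq_inj E; apply/fmapP=> x.
case EG: (G.[? x]%fmap) => [t|].
  by move/bE: EG; rewrite E => /bE ->.
case EH: (H.[? x]%fmap) => [t|//].
by move/bE: EH; rewrite -E => /bE; rewrite EG.
Qed.

Lemma code_instance_inj : injective code_instance.
Proof.
by move=> [e G] [e' G'] /cpair_inj[/code_expr_inj /= -> /code_assignment_inj /= ->].
Qed.

(* Admissible inputs: an expression satisfying [L] and a type assignment on it. *)
Definition instance_of (L : expr -> Prop) (p : expr * type_assignment) : Prop :=
  L p.1 /\ domf p.2 = fv p.1.

Definition well_definedness_decidable (L : expr -> Prop) (atom : countType)
    (content : atom -> {fset node atom} -> atom) (concat : {fset atom} -> atom) :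
    Prop :=
  decidable_on code_instance (instance_of L) (well_defined content concat).

(* Main.v *)
(* Every first-order formula over finite relational structures compiles to an
   expression whose value is nonempty iff the formula holds: a relation is a free
   variable holding a set of nested element nodes, read as the set of label words
   along descending paths, and for-loops quantify over one of the relations.  So a
   type of nodes of bounded depth makes "for every environment" range over all
   finite structures.

   A value f(n, m) = 1 of a mu-recursive f is witnessed by a finite set of
   evaluation facts, each justified by others, over numbers bounded by some B.  A
   structure carrying a linear order is a segment {0, ..., B}, and the formula
   saying that all facts are justified and that f(n, m) = 1 is a fact is then
   satisfiable iff f(n, m) = 1.  The numbers n and m enter the formula by n and m
   nested steps to the successor, so that the code of the instance, a function of
   n, m and the code c of the fixed innermost formula, is mu-recursive, while its
   type assignment depends neither on n nor on m.

   Given a decision procedure d, take for f(n, m) the answer of d on the instance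
   with innermost formula of code n, numbers n and m, and type assignment of code
   m.  With n and m the codes of the innermost formula and type assignment built
   from this very f, the instance is ill-defined iff d declares it well-defined. *)

From HB Require Import structures.
Require Import Defs.
From mathcomp Require Import all_boot finmap zify.

Set Implicit Arguments.
Unset Strict Implicit.
Unset Printing Implicit Defensive.

Local Open Scope fset_scope.
Local Open Scope nat_scope.

(** * Evaluation of mu-recursive functions by finite sets of facts *)

Lemma murec_ind' (P : murec -> Prop) :
  P MuZero -> P MuSucc -> (forall i, P (MuProj i)) ->
  (forall f gs, P f -> (forall i, i < size gs -> P (nth MuZero gs i)) ->
     P (MuComp f gs)) ->
  (forall f g, P f -> P g -> P (MuPrec f g)) ->
  (forall f, P f -> P (MuMin f)) ->
  forall f, P f.
Proof.
move=> P0 PS PP PC PR PM; fix F 1 => -[||i|f gs|f g|f].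
- exact: P0.
- exact: PS.
- exact: PP.
- apply: PC; first exact: F.
  elim: gs => [|g gs IH] i; first by rewrite ltn0; discriminate.
  by case: i => [_|i]; [exact: F | exact: IH].
- exact: PR (F f) (F g).
- exact: PM (F f).
Qed.

(** Serves for the equality test on [murec] and, in [fact_rel], for numbering relations. *)
Fixpoint code_murec (f : murec) : nat :=
  match f with
  | MuZero => cpair 0 0
  | MuSucc => cpair 1 0
  | MuProj i => cpair 2 i
  | MuComp f gs => cpair 3 (cpair (code_murec f) (code_seq (map code_murec gs)))
  | MuPrec f g => cpair 4 (cpair (code_murec f) (code_murec g))
  | MuMin f => cpair 5 (code_murec f)
  end.

Lemma code_murec_inj : injective code_murec.
Proof.
elim/murec_ind'=> [||i|f gs IHf IHg|f g IHf IHg|f IHf] [||j|f' hs|f' g'|f'];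
  move=> /cpair_inj[] //.
- by move=> _ ->.
- move=> _ /cpair_inj[/IHf -> /code_seq_inj E]; congr MuComp.
  elim: gs hs IHg E => [|g gs IH] [|h hs] //= IHg [Eg E].
  have -> : g = h := IHg 0 isT h Eg.
  by rewrite (IH hs) // => i lti; apply: (IHg i.+1).
- by move=> _ /cpair_inj[/IHf -> /IHg ->].
- by move=> _ /IHf ->.
Qed.

HB.instance Definition _ := Equality.copy murec (inj_type code_murec_inj).

(* All pairs (h, k) such that evaluating [f] on [k] arguments may call the
   subterm [h] on [k] arguments. *)
Fixpoint subcalls (f : murec) (k : nat) : seq (murec * nat) :=
  (f, k) :: match f with
  | MuComp f gs =>
      subcalls f (size gs) ++ flatten (map (fun g => subcalls g k) gs)
  | MuPrec f g => subcalls f k.-1 ++ subcalls g k.+1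
  | MuMin f => subcalls f k.+1
  | _ => [::]
  end.

(** Bounds the number of arguments of every call in terms of [f] and [k] alone: the depth of the
    input type is fixed before the actual numbers are. *)
Fixpoint call_width (f : murec) (k : nat) : nat :=
  maxn k match f with
  | MuComp f gs =>
      maxn (call_width f (size gs)) (\max_(w <- map (fun g => call_width g k) gs) w)
  | MuPrec f g => maxn (call_width f k.-1) (call_width g k.+1)
  | MuMin f => call_width f k.+1
  | _ => 0
  end.

Lemma leq_call_width f k : k <= call_width f k.
Proof. by case: f => *; rewrite /= leq_maxl. Qed.

(* One step of the evaluation relation, with [F] in place of the recursive
   premises. *)
Definition justified (F : murec -> seq nat -> nat -> Prop) f s r : Prop :=
  match f with
  | MuZero => r = 0
  | MuSucc => r = (nth 0 s 0).+1
  | MuProj i => r = nth 0 s i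
  | MuComp f gs => exists vs, [/\ size vs = size gs, F f vs r &
      forall i, i < size gs -> F (nth MuZero gs i) s (nth 0 vs i)]
  | MuPrec f' g =>
      match s with
      | [::] => False
      | 0 :: s' => F f' s' r
      | n.+1 :: s' => exists r', F f (n :: s') r' /\ F g [:: n, r' & s'] r
      end
  | MuMin f =>
      F f (r :: s) 0 /\ forall i, i < r -> exists w, F f (i :: s) w.+1
  end.

Lemma justified_mono (F F' : murec -> seq nat -> nat -> Prop) f s r :
  (forall f s r, F f s r -> F' f s r) -> justified F f s r -> justified F' f s r.
Proof.
move=> FF'; case: f => [||i|f gs|f g|f] //=.
- move=> [vs [sz H1 H2]]; exists vs; split=> //; first exact: FF'.
  by move=> i lti; apply: FF'; apply: H2.
- case: s => [|[|n] s] //; first exact: FF'.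
  by move=> [r' [H1 H2]]; exists r'; split; apply: FF'.
- move=> [H1 H2]; split; first exact: FF'.
  by move=> i /H2[w Hw]; exists w; apply: FF'.
Qed.

(** [EvMin] takes the nonzero values met by the search as a function, while [justified] only says
    that each exists. *)
Lemma finite_choice (P : nat -> nat -> Prop) n :
  (forall i, i < n -> exists w, P i w) ->
  exists w : nat -> nat, forall i, i < n -> P i (w i).
Proof.
elim: n => [|n IH] H; first by exists id.
have [i lti|w Hw] := IH; first by apply: H; apply: ltnW.
have [m Hm] := H n (ltnSn n).
exists (fun i => if i == n then m else w i) => i; rewrite ltnS leq_eqVlt.
by case: eqP => [->|_] //=; exact: Hw.
Qed.

(** Circular justification is impossible: each premise concerns a proper subterm, except in
    [MuPrec], where the recursion argument drops. So closure of [F] at the calls listed in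
    [subcalls f k] is enough. *)
Lemma justified_sound (F : murec -> seq nat -> nat -> Prop) f k :
  (forall h s r, (h, size s) \in subcalls f k -> F h s r -> justified F h s r) ->
  forall s r, size s = k -> F f s r -> mu_eval f s r.
Proof.
elim/murec_ind': f k => [||i|f gs IHf IHg|f g IHf IHg|f IHf] k H s r sz HF;
  have /= := H _ s r _ HF; rewrite sz inE eqxx => /(_ isT).
- by move=> ->; constructor.
- by move=> ->; constructor.
- by move=> ->; constructor.
- move=> [vs [szv Hf Hg]]; apply: (@EvComp _ _ _ vs) => // [i lti|].
    apply: (IHg i lti k) => //; last exact: Hg.
    move=> h t u hin; apply: H; rewrite /= inE mem_cat; apply/orP; right.
    apply/orP; right; apply/flattenP; exists (subcalls (nth MuZero gs i) k) => //.
    by apply: (map_f (fun g => subcalls g k)); apply: mem_nth.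
  apply: (IHf (size gs)) => //.
  by move=> h t u hin; apply: H; rewrite /= inE mem_cat hin orbT.
- have Hf t u : size t = k.-1 -> F f t u -> mu_eval f t u.
    apply: (IHf k.-1) => h t' u' hin; apply: H.
    by rewrite /= inE mem_cat hin orbT.
  have Hg t u : size t = k.+1 -> F g t u -> mu_eval g t u.
    apply: (IHg k.+1) => h t' u' hin; apply: H.
    by rewrite /= inE mem_cat hin !orbT.
  (* The premise about [MuPrec f g] itself calls for an inner induction on the recursion
     argument. *)
  case: s sz HF => [|n s] //= sz HF _; elim: n r HF => [|n IHn] r HF.
    constructor; apply: Hf; first by rewrite -sz.
    by have := H _ (0 :: s) r _ HF; rewrite /= sz inE eqxx; apply.
  have := H _ (n.+1 :: s) r _ HF; rewrite /= sz inE eqxx => /(_ isT) [r' [H1 H2]].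
  apply: (@EvPrecS _ _ _ _ r'); first exact: IHn.
  by apply: Hg => //=; rewrite -sz.
- have Hf t u : size t = k.+1 -> F f t u -> mu_eval f t u.
    by apply: (IHf k.+1) => h t' u' hin; apply: H; rewrite /= inE hin orbT.
  move=> [H0 /finite_choice[w Hw]]; apply: (@EvMin _ _ _ w); last first.
    by apply: Hf; rewrite //= sz.
  by move=> i lti; apply: Hf; [rewrite /= sz|apply: Hw].
Qed.

Definition fact : Type := (murec * seq nat * nat)%type.

Definition mem_fact (D : seq fact) f s r : Prop := (f, s, r) \in D.

Definition justified_facts (m : nat) (D : seq fact) : Prop :=
  forall f s r, (f, s, r) \in D -> size s <= m /\ justified (mem_fact D) f s r.

Lemma justified_facts_cat m D1 D2 :
  justified_facts m D1 -> justified_facts m D2 -> justified_facts m (D1 ++ D2).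
Proof.
move=> H1 H2 f s r; rewrite mem_cat => /orP[/H1|/H2] [sz J]; split=> //;
  by apply: justified_mono J => *; rewrite /mem_fact mem_cat; apply/orP; auto.
Qed.

Lemma justified_facts_cons m D f s r :
  size s <= m -> justified (mem_fact D) f s r -> justified_facts m D ->
  justified_facts m ((f, s, r) :: D).
Proof.
have sub f' s' r' : mem_fact D f' s' r' -> mem_fact ((f, s, r) :: D) f' s' r'.
  by rewrite /mem_fact inE => ->; rewrite orbT.
move=> sz J H f' s' r'; rewrite inE => /orP[/eqP[-> -> ->]|/H[sz' J']]; split=> //.
  exact: justified_mono J.
exact: justified_mono J'.
Qed.

Lemma justified_facts_leq m m' D :
  m <= m' -> justified_facts m D -> justified_facts m' D.
Proof.
by move=> le H f s r /H[sz J]; split=> //; apply: leq_trans le.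
Qed.

Lemma justified_facts_family m n (P : nat -> fact) :
  (forall i, i < n -> exists D, P i \in D /\ justified_facts m D) ->
  exists D, (forall i, i < n -> P i \in D) /\ justified_facts m D.
Proof.
elim: n => [|n IH] H; first by exists [::].
have [i lti|D [HD JD]] := IH; first by apply: H; apply: ltnW.
have [D' [HD' JD']] := H n (ltnSn n).
exists (D' ++ D); split; last exact: justified_facts_cat.
move=> i; rewrite ltnS leq_eqVlt mem_cat => /orP[/eqP ->|/HD ->].
  by rewrite HD'.
by rewrite orbT.
Qed.

(** [D] collects the conclusions occurring in the finite evaluation tree: the union of the sets
    obtained for the premises, with the final conclusion added. *)
Lemma justified_complete f s r : mu_eval f s r ->
  exists D, (f, s, r) \in D /\ justified_facts (call_width f (size s)) D.
Proof.
have nilJ m : justified_facts m [::] by [].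
elim=> {f s r}.
- move=> s; exists [:: (MuZero, s, 0)]; rewrite mem_head; split=> //.
  by apply: justified_facts_cons => //; apply: leq_call_width.
- move=> s; exists [:: (MuSucc, s, (nth 0 s 0).+1)]; rewrite mem_head; split=> //.
  by apply: justified_facts_cons => //; apply: leq_call_width.
- move=> i s; exists [:: (MuProj i, s, nth 0 s i)]; rewrite mem_head; split=> //.
  by apply: justified_facts_cons => //; apply: leq_call_width.
- move=> f gs s vs r sz _ IHg _ [D [HD JD]].
  set m := call_width _ _.
  have [|D' [HD' JD']] := @justified_facts_family m (size gs)
      (fun i => (nth MuZero gs i, s, nth 0 vs i)).
    move=> i lti; have [D' [HD' JD']] := IHg i lti; exists D'; split=> //.
    apply: justified_facts_leq JD'; rewrite /m /= !leq_max; apply/orP; right.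
    apply/orP; right; rewrite big_map.
    apply: (@leq_bigmax_seq _ gs xpredT (fun g => call_width g (size s))) => //.
    exact: mem_nth.
  exists ((MuComp f gs, s, r) :: D' ++ D); rewrite mem_head; split=> //.
  apply: justified_facts_cons; first exact: leq_call_width.
    exists vs; split=> //; first by rewrite /mem_fact mem_cat HD orbT.
    by move=> i lti; rewrite /mem_fact mem_cat HD'.
  apply: justified_facts_cat => //; apply: justified_facts_leq JD.
  by rewrite /m /= sz !leq_max leqnn orbT.
- move=> f g s r _ [D [HD JD]].
  exists ((MuPrec f g, 0 :: s, r) :: D); rewrite mem_head; split=> //.
  apply: justified_facts_cons; [exact: leq_call_width|exact: HD|].
  by apply: justified_facts_leq JD; rewrite /= !leq_max leqnn orbT.
- move=> f g n s r r' _ [D [HD JD]] _ [D' [HD' JD']].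
  exists ((MuPrec f g, n.+1 :: s, r') :: D ++ D'); rewrite mem_head; split=> //.
  apply: justified_facts_cons; first exact: leq_call_width.
    by exists r; split; rewrite /mem_fact mem_cat ?HD ?HD' ?orbT.
  apply: justified_facts_cat; first exact: JD.
  by apply: justified_facts_leq JD'; rewrite /= !leq_max leqnn !orbT.
- move=> f s n w _ IHw _ [D [HD JD]].
  have [|D' [HD' JD']] := @justified_facts_family (call_width f (size s).+1) n
      (fun i => (f, i :: s, (w i).+1)).
    by move=> i lti; have [D' [HD' JD']] := IHw i lti; exists D'.
  exists ((MuMin f, s, n) :: D' ++ D); rewrite mem_head; split=> //.
  apply: justified_facts_cons; first exact: leq_call_width.
    split; first by rewrite /mem_fact mem_cat HD orbT.
    by move=> i lti; exists (w i); rewrite /mem_fact mem_cat HD'.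
  apply: justified_facts_cat;
    [apply: justified_facts_leq JD'|apply: justified_facts_leq JD];
    exact: leq_maxr.
Qed.

(** * Mu-recursive computation of the codes of instances *)

Definition add_mu := MuPrec (MuProj 0) (MuComp MuSucc [:: MuProj 1]).

Lemma eval_comp1 f g s a r :
  mu_eval g s a -> mu_eval f [:: a] r -> mu_eval (MuComp f [:: g]) s r.
Proof. by move=> Hg Hf; apply: (@EvComp _ _ _ [:: a]) => // -[|i]. Qed.

Lemma eval_comp1_inv f g s a r :
  mu_eval g s a -> mu_eval (MuComp f [:: g]) s r -> mu_eval f [:: a] r.
Proof.
move=> Hg H; inversion H as [| | |f' gs s' vs r' sz Hgs Hf| | |]; subst.
case: vs sz Hgs Hf => [|v [|]] // _ /(_ 0 isT) Hv.
by rewrite (mu_eval_det Hg Hv).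
Qed.

Lemma eval_comp2 f g h s a b r :
  mu_eval g s a -> mu_eval h s b -> mu_eval f [:: a; b] r ->
  mu_eval (MuComp f [:: g; h]) s r.
Proof. by move=> Hg Hh Hf; apply: (@EvComp _ _ _ [:: a; b]) => // -[|[|i]]. Qed.

Lemma eval_add m n s : mu_eval add_mu [:: m, n & s] (m + n).
Proof.
elim: m => [|m IH]; first by constructor; apply: (EvProj 0).
apply: (EvPrecS IH); apply: (@eval_comp1 _ _ _ (m + n)); first exact: (EvProj 1).
exact: (EvSucc [:: m + n]).
Qed.

(** Recursion by Pascal's rule: ['C(n.+1, 2) = 'C(n, 2) + n]. *)
Definition bin2_mu :=
  MuPrec MuZero (MuComp add_mu [:: MuProj 0; MuProj 1]).

Lemma eval_bin2 n s : mu_eval bin2_mu (n :: s) 'C(n, 2).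
Proof.
elim: n => [|n IH]; first by constructor; constructor.
apply: (EvPrecS IH); apply: (@eval_comp2 _ _ _ _ n 'C(n, 2)).
- exact: (EvProj 0).
- exact: (EvProj 1).
- by rewrite binS bin1 addnC; apply: eval_add.
Qed.

Definition cpair_mu :=
  MuComp add_mu [:: MuComp bin2_mu [:: MuComp MuSucc [:: add_mu]]; MuProj 1].

Lemma eval_cpair x y : mu_eval cpair_mu [:: x; y] (cpair x y).
Proof.
apply: eval_comp2; [|exact: (EvProj 1)|exact: eval_add].
apply: (@eval_comp1 _ _ _ (x + y).+1); last exact: eval_bin2.
by apply: eval_comp1; [apply: eval_add|apply: EvSucc].
Qed.

Definition const_mu (n : nat) := iter n (fun f => MuComp MuSucc [:: f]) MuZero.

Lemma eval_const n s : mu_eval (const_mu n) s n.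
Proof.
elim: n => [|n IH]; first exact: EvZero.
apply: eval_comp1; [exact: IH|exact: (EvSucc [:: n])].
Qed.

(* [cs] is the code of a context whose hole is the last component throughout. *)
Definition plug (cs : seq nat) (c : nat) : nat := foldr cpair c cs.

Definition plug_mu (cs : seq nat) (f : murec) : murec :=
  foldr (fun c g => MuComp cpair_mu [:: const_mu c; g]) f cs.

Lemma eval_plug cs f s c : mu_eval f s c -> mu_eval (plug_mu cs f) s (plug cs c).
Proof.
move=> H; elim: cs => //= c' cs IH.
by apply: eval_comp2; [apply: eval_const|apply: IH|apply: eval_cpair].
Qed.

Definition iter_plug_mu (cs : seq nat) (f : murec) : murec :=
  MuPrec f (plug_mu cs (MuProj 1)).

Lemma eval_iter_plug cs f n s c : mu_eval f s c ->
  mu_eval (iter_plug_mu cs f) (n :: s) (iter n (plug cs) c).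
Proof.
move=> H; elim: n => [|n IH]; first by constructor.
by apply: (EvPrecS IH); apply: eval_plug; apply: (EvProj 1).
Qed.

(** Each argument serves twice: the first as the code of the innermost formula and as a number of
    steps, the second as a number of steps and as the code of the type assignment. *)
Definition instance_code_mu (cs0 cs1 cs2 cs3 : seq nat) : murec :=
  MuComp cpair_mu
    [:: plug_mu cs0
          (MuComp (iter_plug_mu cs1 (plug_mu cs2 (MuProj 0)))
            [:: MuProj 0;
                MuComp (iter_plug_mu cs3 (MuProj 0)) [:: MuProj 1; MuProj 0]]);
        MuProj 1].

Lemma eval_instance_code cs0 cs1 cs2 cs3 n m :
  mu_eval (instance_code_mu cs0 cs1 cs2 cs3) [:: n; m]
    (cpair (plug cs0 (iter n (plug cs1) (plug cs2 (iter m (plug cs3) n)))) m).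
Proof.
apply: eval_comp2; [|exact: (EvProj 1)|exact: eval_cpair].
apply: eval_plug; apply: eval_comp2; first exact: (EvProj 0).
  apply: eval_comp2; [exact: (EvProj 1)|exact: (EvProj 0)|].
  by apply: eval_iter_plug; apply: (EvProj 0).
by apply: eval_iter_plug; apply: eval_plug; apply: (EvProj 0).
Qed.

(** * First-order formulas and their compilation *)

Inductive form : Type :=
| FEq of nat & nat
| FRel of nat & seq nat
| FNot of form
| FAnd of form & form
| FEx of nat & form.

Definition FOr phi psi := FNot (FAnd (FNot phi) (FNot psi)).
Definition FImp phi psi := FNot (FAnd phi (FNot psi)).
Definition FAll x phi := FNot (FEx x (FNot phi)).
Definition FTrue := FAll 0 (FEq 0 0).
Definition FAnds phis := foldr FAnd FTrue phis.
Definition FAlls xs phi := foldr FAll phi xs.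
Definition FExs xs phi := foldr FEx phi xs.

Fixpoint free_names (phi : form) : seq nat :=
  match phi with
  | FEq x y => [:: x; y]
  | FRel _ xs => xs
  | FNot phi => free_names phi
  | FAnd phi psi => free_names phi ++ free_names psi
  | FEx x phi => [seq y <- free_names phi | y != x]
  end.

Definition universal_closure phi := FAlls (free_names phi) phi.

Fixpoint max_arity (phi : form) : nat :=
  match phi with
  | FEq _ _ => 0
  | FRel _ xs => size xs
  | FNot phi | FEx _ phi => max_arity phi
  | FAnd phi psi => maxn (max_arity phi) (max_arity psi)
  end.

Lemma free_names_FAlls xs phi :
  free_names (FAlls xs phi) = [seq y <- free_names phi | y \notin xs].
Proof.
elim: xs => [|x xs IH] /=; first by rewrite filter_predT.
rewrite IH -filter_predI; apply: eq_filter => y /=.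
by rewrite inE negb_or.
Qed.

Lemma free_names_closure phi : free_names (universal_closure phi) = [::].
Proof.
rewrite free_names_FAlls; apply/eqP; rewrite -[_ == _]negbK -has_filter.
by apply/hasPn => y yin; rewrite /= yin.
Qed.

Lemma free_names_FAnds phis :
  free_names (FAnds phis) = flatten (map free_names phis).
Proof. by elim: phis => //= phi phis ->. Qed.

Definition upd (A : Type) (rho : nat -> A) x a : nat -> A :=
  fun y => if y == x then a else rho y.

Section Sat.

Variables (A : eqType) (dom : seq A) (R : nat -> seq A -> bool).

Fixpoint sat (rho : nat -> A) (phi : form) : bool :=
  match phi with
  | FEq x y => rho x == rho y
  | FRel j xs => R j (map rho xs)
  | FNot phi => ~~ sat rho phi
  | FAnd phi psi => sat rho phi && sat rho psi
  | FEx x phi => has (fun a => sat (upd rho x a) phi) dom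
  end.

Lemma eq_in_sat rho rho' phi :
  {in free_names phi, rho =1 rho'} -> sat rho phi = sat rho' phi.
Proof.
elim: phi rho rho' => [x y|j xs|phi IH|phi IHp psi IHq|x phi IH] rho rho' E /=.
- by rewrite !E // !inE eqxx ?orbT.
- by congr R; apply/eq_in_map.
- by rewrite (IH _ _ E).
- by rewrite (IHp _ rho') 1?(IHq _ rho') // => y yin;
    apply: E; rewrite mem_cat yin ?orbT.
- apply: eq_has => a; apply: IH => y yin; rewrite /upd; case: eqP => // /eqP yx.
  by apply: E; rewrite mem_filter yx.
Qed.

Lemma eq_sat rho rho' phi : rho =1 rho' -> sat rho phi = sat rho' phi.
Proof. by move=> E; apply: eq_in_sat => x _. Qed.

Lemma sat_FOr rho phi psi : sat rho (FOr phi psi) = sat rho phi || sat rho psi.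
Proof. by rewrite /= negb_and !negbK. Qed.

Lemma sat_FImp rho phi psi : sat rho (FImp phi psi) = (sat rho phi ==> sat rho psi).
Proof. by rewrite /= negb_and negbK implybE. Qed.

Lemma sat_FAll rho x phi :
  sat rho (FAll x phi) = all (fun a => sat (upd rho x a) phi) dom.
Proof. by rewrite /= -all_predC; apply: eq_all => a; rewrite /= negbK. Qed.

Lemma sat_FTrue rho : sat rho FTrue.
Proof. by rewrite sat_FAll; apply/allP => a _ /=. Qed.

Lemma sat_FAnds rho phis : sat rho (FAnds phis) = all (sat rho) phis.
Proof. by elim: phis => [|phi phis IH]; rewrite ?sat_FTrue //= -IH. Qed.

(** One joint assignment to all of [xs], instead of one value per quantifier, makes the repetitions
    that [free_names] may produce harmless. *)
Lemma sat_FAlls rho xs phi :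
  sat rho (FAlls xs phi) <->
  (forall rho', {in [predC xs], rho' =1 rho} -> {in xs, forall x, rho' x \in dom} ->
     sat rho' phi).
Proof.
elim: xs rho => [|x xs IH] rho.
  split=> [H rho' E _|]; last by apply.
  by rewrite (@eq_sat _ rho) // => x; apply: E.
rewrite [FAlls _ _]/= sat_FAll; split.
  move=> /allP H rho' E D; have /H/IH : rho' x \in dom by apply: D; rewrite mem_head.
  apply=> [y yxs|y yxs]; last by apply: D; rewrite inE yxs orbT.
  rewrite /upd; case: eqP => [->//|/eqP yx]; apply: E.
  by move: yxs; rewrite !inE negb_or yx.
move=> H; apply/allP => a ain; apply/IH => rho' E D; apply: H.
  move=> y; rewrite !inE negb_or => /andP[yx yxs].
  by rewrite E // /upd (negPf yx).
move=> y; rewrite inE => /orP[/eqP ->|]; last exact: D.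
(* If [x] recurs in [xs], an inner quantifier already puts its value in [dom]; otherwise that value
   is [a]. *)
case: (boolP (x \in xs)) => [|xxs]; first exact: D.
by rewrite E // /upd eqxx.
Qed.

Lemma sat_FExs rho xs phi :
  sat rho (FExs xs phi) <->
  (exists rho', [/\ {in [predC xs], rho' =1 rho}, {in xs, forall x, rho' x \in dom} &
     sat rho' phi]).
Proof.
elim: xs rho => [|x xs IH] rho.
  split=> [H|[rho' [E _]]]; first by exists rho.
  by rewrite (@eq_sat _ rho) // => x; apply: E.
rewrite [FExs _ _]/=; split.
  move=> /hasP[a ain /IH[rho' [E D H]]]; exists rho'; split=> //.
    move=> y; rewrite !inE negb_or => /andP[yx yxs].
    by rewrite E // /upd (negPf yx).
  move=> y; rewrite inE => /orP[/eqP ->|]; last exact: D.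
  case: (boolP (x \in xs)) => [|xxs]; first exact: D.
  by rewrite E // /upd eqxx.
move=> [rho' [E D H]]; apply/hasP; exists (rho' x); first by apply: D; rewrite mem_head.
apply/IH; exists rho'; split=> //; last by move=> y yxs; apply: D; rewrite inE yxs orbT.
move=> y yxs; rewrite /upd; case: eqP => [->//|/eqP yx]; apply: E.
by move: yxs; rewrite !inE negb_or yx.
Qed.

Lemma sat_closure rho phi :
  sat rho (universal_closure phi) <->
  (forall rho', {in free_names phi, forall x, rho' x \in dom} -> sat rho' phi).
Proof.
split=> [/sat_FAlls H rho' D|H]; last by apply/sat_FAlls => rho' _; apply: H.
rewrite (@eq_in_sat _ (fun x => if x \in free_names phi then rho' x else rho x)).
  apply: H => x; first by rewrite inE /= => /negPf ->.
  by move=> xin; rewrite xin; apply: D.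
by move=> x ->.
Qed.

End Sat.

Lemma eq_sat_dom (A : eqType) (dom dom' : seq A) R rho phi : dom =i dom' ->
  sat dom R rho phi = sat dom' R rho phi.
Proof.
move=> E; elim: phi rho => //= [phi IH|phi IHp psi IHq|x phi IH] rho.
- by rewrite IH.
- by rewrite IHp IHq.
- by rewrite (eq_has_r E); apply: eq_has => a; apply: IH.
Qed.

(* Relation [j] is read off the free variable [2j + 1], the individual named [x]
   off the bound variable [2x + 2]; 0 is left for scratch. *)
Definition rel_var (j : nat) : var := j.*2.+1.
Definition ind_var (x : nat) : var := x.*2.+2.

(** The language has no atom literals; the name of the empty value supplies a nonempty value in
    every environment. *)
Definition tt_expr := Name Empty.

(** Taking names first makes [eq] compare labels, so the arbitrary oracle [content] is never
    consulted. *)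
Definition ite_eq x y e := IfEq (Name (Var x)) (Name (Var y)) e Empty.

(** One scratch variable suffices, because the source of the inner loop is evaluated before variable
    0 is rebound. *)
Fixpoint path_expr (e : expr) (xs : seq nat) : expr :=
  match xs with
  | [::] => tt_expr
  | x :: xs => For 0 any_kind e
      (ite_eq 0 (ind_var x) (path_expr (Children (Var 0)) xs))
  end.

(** Relation 0 serves as the domain: a quantifier runs through its trees, each standing for its root
    label. *)
Fixpoint compile (phi : form) : expr :=
  match phi with
  | FEq x y => ite_eq (ind_var x) (ind_var y) tt_expr
  | FRel j xs => path_expr (Var (rel_var j)) xs
  | FNot phi => IfEmpty (compile phi) tt_expr Empty
  | FAnd phi psi => IfEmpty (compile phi) Empty (compile psi)
  | FEx x phi => For (ind_var x) any_kind (Var (rel_var 0)) (compile phi)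
  end.

Lemma perx_compile phi : perx_empty (compile phi).
Proof.
have path_perx e xs : perx_empty e -> perx_empty (path_expr e xs).
  by elim: xs e => //= x xs IH e He; do 2?split=> //; apply: IH.
by elim: phi => //= j xs; apply: path_perx.
Qed.

Lemma fv_path_expr e xs y : y \in fv (path_expr e xs) ->
  y \in fv e \/ exists2 x, x \in xs & y = ind_var x.
Proof.
elim: xs e => [|x xs IH] e //=; rewrite !inE => /orP[->|/andP[y0]]; first by left.
rewrite (negPf y0) orbF /= => /orP[/eqP ->|/IH[|]].
- by right; exists x; rewrite ?mem_head.
- by rewrite inE (negPf y0).
- by move=> [z zin ->]; right; exists z; rewrite // inE zin orbT.
Qed.

Lemma mem_path_expr e x xs : fv e `<=` fv (path_expr e (x :: xs)) /\
  forall z, z \in x :: xs -> ind_var z \in fv (path_expr e (x :: xs)).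
Proof.
split; first exact: fsubsetUl.
elim: xs x e => [|x' xs IH] x e z.
  by rewrite inE => /eqP ->; rewrite !inE /= eqxx !orbT.
rewrite inE => /orP[/eqP ->|zin]; first by rewrite !inE /= eqxx !orbT.
by have := IH x' (Children (Var 0)) z zin;
  rewrite [path_expr e _]/= !inE /= => ->; rewrite !orbT.
Qed.

Lemma ind_var_inj : injective ind_var.
Proof. by move=> x y; rewrite /ind_var; lia. Qed.

Lemma fv_compile phi y : y \in fv (compile phi) ->
  (exists j, y = rel_var j) \/ exists2 x, x \in free_names phi & y = ind_var x.
Proof.
elim: phi => [x z|j xs|phi IH|phi IHp psi IHq|x phi IH] /=.
- rewrite !inE !orbF => /orP[]/eqP ->; right; [exists x|exists z] => //;
    by rewrite !inE eqxx ?orbT.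
- move=> /fv_path_expr[/=|]; last by right.
  by rewrite inE => /eqP ->; left; exists j.
- by rewrite !inE !orbF; apply: IH.
- rewrite !inE orbF => /orP[/IHp|/IHq] [|[x xin ->]]; try (by left);
    by right; exists x; rewrite // mem_cat xin ?orbT.
- rewrite !inE => /orP[/eqP ->|/andP[yx /IH[|[z zin Ez]]]]; try (by left).
    by left; exists 0.
  right; exists z => //; rewrite mem_filter zin andbT.
  by apply: contra yx => /eqP <-; rewrite Ez.
Qed.

(** * Correctness of the compilation, and values with prescribed words *)

Section Compile.

Variables (atom : countType) (content : atom -> {fset node atom} -> atom)
  (concat : {fset atom} -> atom).

Local Notation eval := (eval content concat).

Definition item_label (i : item atom) : atom :=
  match i with inl a => a | inr n => node_label n end.

(* A value is read as the set of the words that label its descending paths. *)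
Fixpoint has_path (v : value atom) (t : seq atom) : bool :=
  match t with
  | [::] => true
  | a :: t => has (fun i => (item_label i == a) && has_path (item_children i) t) v
  end.

(** The first [m] levels consist of element nodes, so that reading a word of length at most [m] only
    takes names where they are defined. Collections may be empty, so shorter paths are allowed. *)
Fixpoint trie_type (m : nat) : ntype :=
  if m is m'.+1 then NElem (GColl (trie_type m')) else NData.

Definition trie_rxtype (m : nat) : rxtype := RColl (INode (trie_type m)).

Lemma trie_item m (v : value atom) i : in_rxtype (trie_rxtype m.+1) v -> i \in v ->
  exists n, [/\ i = inr n, is_elem n & in_rxtype (trie_rxtype m) (item_children i)].
Proof.
move=> /allP H /H; case: i => // n /= /andP[en /allP Hn]; exists n; split=> //.
by apply/allP => _ /imfsetP[k /= kin ->] /=; apply: Hn.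
Qed.

(** With one fixed value for truth, the union formed by a loop is again of this form and computes a
    disjunction. *)
Definition truth (b : bool) : value atom :=
  if b then atom_value (concat fset0) else fset0.

Lemma truth_nil b : (truth b == fset0) = ~~ b.
Proof.
case: b; last exact: eqxx.
by apply/negP => /eqP/fsetP/(_ (inl (concat fset0))); rewrite !inE eqxx.
Qed.

Lemma eval_For_truth s x e1 e2 v b : eval s e1 = Some v ->
  (forall i, i \in v -> eval s.[x <- [fset i]]%fmap e2 = Some (truth (b i))) ->
  eval s (For x any_kind e1 e2) = Some (truth (has b v)).
Proof.
have ak (i : item atom) : in_kind any_kind i by case: i => // n /=; case: is_elem.
(* All that matters about the kind is that it contains every item. *)
move: any_kind ak => k ak E1 E2 /=; rewrite E1.
rewrite ifT; last by apply/allP => i iin; rewrite ak E2.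
congr Some; apply/fsetP => x0; apply/bigfcupP/idP => [[i]|].
  rewrite ak andbT => iin; rewrite (E2 i iin) /= /truth.
  case: ifP => // bi; rewrite inE => /eqP ->.
  by have -> : has b v by [apply/hasP; exists i]; rewrite inE.
rewrite /truth; case: hasP => // -[i iin bi] x0in; exists i; first by rewrite iin ak.
by rewrite E2 //= /truth bi.
Qed.

Definition elem_binding (s : env atom) (y : var) (a : atom) : Prop :=
  exists n, [/\ s.[? y]%fmap = Some [fset inr n], is_elem n & node_label n = a].

Lemma elem_binding_set s x v y a : y != x ->
  elem_binding s y a -> elem_binding s.[x <- v]%fmap y a.
Proof. by move=> /negPf yx [n H]; exists n; rewrite fnd_set yx. Qed.

Lemma eval_ite_eq s x y a b e v : elem_binding s x a -> elem_binding s y b ->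
  (a = b -> eval s e = Some v) ->
  eval s (ite_eq x y e) = Some (if a == b then v else fset0).
Proof.
move=> [n [Ex en <-]] [m [Ey em <-]] Ee; rewrite /= Ex Ey /name -!fset_seq1 en em.
rewrite /data /atom_value !imfset_fset1 -!fset_seq1 /=.
by case: eqP => [/Ee|].
Qed.

Lemma eval_path_expr s e v m xs (rho : nat -> atom) :
  eval s e = Some v -> in_rxtype (trie_rxtype m) v -> size xs <= m ->
  {in xs, forall x, elem_binding s (ind_var x) (rho x)} ->
  eval s (path_expr e xs) = Some (truth (has_path v (map rho xs))).
Proof.
elim: xs s e v m => [|x xs IH] s e v [|m] // Ee tv szm Hxs.
rewrite [path_expr _ _]/= [map _ _]/= [has_path _ _]/=.
apply: eval_For_truth => // i iin.
have [n [Ei en tn]] := trie_item tv iin.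
have b0 : elem_binding s.[0 <- [fset i]]%fmap 0 (item_label i).
  by exists n; rewrite fnd_set eqxx Ei.
have bxs : {in x :: xs, forall y,
    elem_binding s.[0 <- [fset i]]%fmap (ind_var y) (rho y)}.
  by move=> y yin; apply: elem_binding_set => //; apply: Hxs.
have Ec : eval s.[0 <- [fset i]]%fmap (Children (Var 0)) = Some (item_children i).
  by rewrite /= fnd_set eqxx /children Ei -fset_seq1 /= big_seq1.
rewrite (eval_ite_eq b0 (bxs x (mem_head _ _)) (fun _ => IH _ _ _ m Ec tn szm _)).
  by case: eqP.
by move=> _ y yin; apply: bxs; rewrite inE yin orbT.
Qed.

Definition rel_binding (s : env atom) (m : nat) (y : var) (P : seq atom -> bool) :=
  exists v, [/\ s.[? y]%fmap = Some v, in_rxtype (trie_rxtype m) v & has_path v =1 P].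

(** [0 < m] makes the roots element nodes, so that a quantified individual has a name. [R j [::]]
    must hold because [has_path] accepts the empty word in every value. *)
Lemma eval_compile m (dom : seq atom) (R : nat -> seq atom -> bool) phi s rho :
  0 < m -> max_arity phi <= m ->
  (forall j, R j [::]) -> (forall a, (a \in dom) = R 0 [:: a]) ->
  (forall j, rel_var j \in fv (compile phi) -> rel_binding s m (rel_var j) (R j)) ->
  (forall x, ind_var x \in fv (compile phi) -> elem_binding s (ind_var x) (rho x)) ->
  eval s (compile phi) = Some (truth (sat dom R rho phi)).
Proof.
move=> m_gt0 + R0 Rdom.
elim: phi s rho => [x y|j [|x xs]|phi IH|phi IHp psi IHq|x phi IH] s rho;
  rewrite [max_arity _]/= [compile _]/= [sat _ _ _ _]/=.
- move=> _ _ H; have -> := @eval_ite_eq s _ _ (rho x) (rho y) tt_expr (truth true).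
  + by case: eqP.
  + by apply: H; rewrite !inE eqxx.
  + by apply: H; rewrite !inE eqxx orbT.
  + by [].
- by rewrite R0.
- move=> szm Hj Hx; have [] := @mem_path_expr (Var (rel_var j)) x xs.
  move=> /fsubsetP/(_ (rel_var j))/= Hj'.
  have /Hj[v [Ev tv <-]] :
      rel_var j \in fv (path_expr (Var (rel_var j)) (x :: xs)).
    by apply: Hj'; rewrite inE.
  move=> Hz; apply: (@eval_path_expr _ (Var _) v m (x :: xs) rho) => // z /Hz.
  exact: Hx.
- move=> am Hj Hx; rewrite /= (IH s rho) //.
  + by rewrite truth_nil; case: (sat _ _ _ _).
  + by move=> j jin; apply: Hj; rewrite !inE jin.
  + by move=> j jin; apply: Hx; rewrite !inE jin.
- rewrite geq_max => /andP[amp amq] Hj Hx; rewrite /= (IHp s rho) //.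
  + rewrite truth_nil; case: (sat _ _ _ phi) => //=; apply: IHq => //.
    * by move=> j jin; apply: Hj; rewrite !inE jin ?orbT.
    * by move=> j jin; apply: Hx; rewrite !inE jin ?orbT.
  + by move=> j jin; apply: Hj; rewrite !inE jin ?orbT.
  + by move=> j jin; apply: Hx; rewrite !inE jin ?orbT.
- move=> am Hj Hx; have [|v [Ev tv pv]] := Hj 0; first by rewrite !inE.
  (* Distinct trees may share a root label, but looping over trees and looping over labels try the
     same individuals. *)
  have -> : has (fun a => sat dom R (upd rho x a) phi) dom =
            has (fun i => sat dom R (upd rho x (item_label i)) phi) v.
    have memd a : (a \in dom) = has (fun i => item_label i == a) v.
      by rewrite Rdom -pv /=; apply: eq_has => i; rewrite andbT.
    apply/hasP/hasP => [[a + H]|[i iin H]].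
      by rewrite memd => /hasP[i iin /eqP E]; exists i; rewrite ?E.
    by exists (item_label i) => //; rewrite memd; apply/hasP; exists i.
  pose b i := sat dom R (upd rho x (item_label i)) phi.
  apply: (@eval_For_truth _ _ _ _ v b) => // i iin; apply: IH => //.
    move=> j jin; have [|w [Ew tw pw]] := Hj j.
      by rewrite !inE jin andbT /rel_var /ind_var; apply/orP; right; lia.
    exists w; split=> //; rewrite fnd_set ifF //; rewrite /rel_var /ind_var; lia.
  move=> y yin; rewrite /upd; case: eqP => [->|/eqP yx].
    case: m m_gt0 tv {Hj am} => // m _ tv; have [n [Ei en _]] := trie_item tv iin.
    by exists n; rewrite fnd_set eqxx Ei.
  have yx' : ind_var y != ind_var x by rewrite (inj_eq ind_var_inj).
  by apply: elem_binding_set => //; apply: Hx; rewrite !inE yx' yin orbT.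
Qed.

Definition nodes_value (N : {fset node atom}) : value atom := [fset inr n | n in N].

Fixpoint chain (l : seq atom) : {fset node atom} :=
  if l is a :: l then [fset elem_node a (chain l)] else fset0.

Definition trie (L : seq (seq atom)) : value atom :=
  \bigcup_(l <- L) nodes_value (chain l).

(** A chain ends with an empty set of children, which every [GColl] admits, so words shorter than
    [m] fit too. *)
Lemma trie_typed m L : {in L, forall l, size l <= m} ->
  in_rxtype (trie_rxtype m) (trie L).
Proof.
have typed l : size l <= m -> all (in_ntype (trie_type m)) (chain l).
  elim: m l => [|m IH] [|a l] //= szl; rewrite -fset_seq1 /= andbT.
  by rewrite node_children_elem IH.
move=> H; apply/allP => i /bigfcupP[l]; rewrite andbT => /H/typed/allP tl.
by move=> /imfsetP[n /= nin ->]; apply: tl.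
Qed.

(** A path may stop before a leaf, hence prefixes. The word is nonempty because the empty path
    exists even in the trie of no words. *)
Lemma has_path_trie L a t :
  has_path (trie L) (a :: t) = has (prefix (a :: t)) L.
Proof.
have path_chain l u : has_path (nodes_value (chain l)) u = prefix u l.
  elim: l u => [|b l IH] [|c u] //=.
    by apply/hasP => -[i /imfsetP[n]].
  rewrite /nodes_value imfset_fset1 -fset_seq1 /= orbF node_children_elem.
  by rewrite -/(nodes_value _) IH eq_sym.
apply/hasP/hasP => [[i /bigfcupP[l]]|[l lin]].
  rewrite andbT => lin iin H; exists l => //; rewrite -path_chain.
  by apply/hasP; exists i.
rewrite -path_chain => /hasP[i iin H]; exists i => //.
by apply/bigfcupP; exists l; rewrite ?lin.
Qed.

End Compile.

(** * Evaluation facts in finite linear orders *)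

Definition FLt x y := FRel 1 [:: x; y].

Definition FIrreflexive := FAll 0 (FNot (FLt 0 0)).

Definition FTransitive :=
  FAll 0 (FAll 1 (FAll 2 (FImp (FAnd (FLt 0 1) (FLt 1 2)) (FLt 0 2)))).

Definition FTotal := FAll 0 (FAll 1 (FOr (FEq 0 1) (FOr (FLt 0 1) (FLt 1 0)))).

Definition FOrder := FAnd FIrreflexive (FAnd FTransitive FTotal).

Definition FZero x := FNot (FEx x.+1 (FLt x.+1 x)).

(* [(x + y).+1] is a name distinct from [x] and [y]. *)
Definition FSucc x y :=
  let z := (x + y).+1 in
  FAnd (FLt x y) (FNot (FEx z (FAnd (FLt x z) (FLt z y)))).

(** Relations 0 and 1 are the domain and the order. With the arity in the number, a relation can be
    given words of a single length, and a prefix of one fact cannot pass for another. *)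
Definition fact_rel (f : murec) (k : nat) : nat := (cpair (code_murec f) k).+2.

Definition FFact f r xs := FRel (fact_rel f (size xs)) (r :: xs).

(** A missing argument is read as 0, as in [mu_eval]. *)
Definition FNth i k y := if i < k then FEq y i.+1 else FZero y.

(* The arguments are the individuals named 1, ..., k; the value is that named 0. *)
Definition FJustified (f : murec) (k : nat) : form :=
  let args := iota 1 k in
  match f with
  | MuZero => FZero 0
  | MuSucc => FEx k.+1 (FAnd (FNth 0 k k.+1) (FSucc k.+1 0))
  | MuProj i => FNth i k 0
  | MuComp f gs =>
      let vs := iota k.+1 (size gs) in
      FExs vs (FAnd (FFact f 0 vs)
        (FAnds [seq FFact (nth MuZero gs i) (k.+1 + i) args | i <- iota 0 (size gs)]))
  | MuPrec f' g =>
      if k is k'.+1 then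
        let args' := iota 2 k' in
        FOr (FAnd (FZero 1) (FFact f' 0 args'))
          (FEx k.+1 (FEx k.+2 (FAnd (FSucc k.+1 1)
            (FAnd (FFact f k.+2 (k.+1 :: args'))
               (FFact g 0 [:: k.+1, k.+2 & args'])))))
      else FNot FTrue
  | MuMin f =>
      FAnd (FEx k.+1 (FAnd (FZero k.+1) (FFact f k.+1 (0 :: args))))
        (FAll k.+1 (FImp (FLt k.+1 0)
          (FEx k.+2 (FAnd (FNot (FZero k.+2)) (FFact f k.+2 (k.+1 :: args))))))
  end.

Definition FFactsJustified (f : murec) (k : nat) : form :=
  FAnds [seq universal_closure
           (FImp (FFact p.1 0 (iota 1 p.2)) (FJustified p.1 p.2))
        | p <- subcalls f k].

(** The successor is named [x.+1] and then renamed [x]. As the same two names are reused, nesting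
    steps iterates one fixed context of codes. *)
Definition FStep x phi :=
  FEx x.+1 (FAnd (FSucc x x.+1) (FEx x (FAnd (FEq x x.+1) phi))).

(** The name 4 denotes the number 1, as the successor of the zero named 5. *)
Definition FAccepts (f : murec) : form :=
  FAnd (FFactsJustified f 2)
    (FEx 4 (FAnd (FEx 5 (FAnd (FZero 5) (FSucc 5 4))) (FFact f 4 [:: 0; 2]))).

(* The individuals named 0 and 2 become the numbers n and m; 1 and 3 are scratch
   names of [FStep]. *)
Definition FInput (n m : nat) (phi : form) : form :=
  FAnd FOrder (FEx 0 (FAnd (FZero 0) (iter n (FStep 0)
    (FEx 2 (FAnd (FZero 2) (iter m (FStep 2) phi)))))).

Lemma upd_neq (A : Type) (rho : nat -> A) x a y :
  y != x -> upd rho x a y = rho y.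
Proof. by rewrite /upd => /negPf ->. Qed.

Lemma upd_eq (A : Type) (rho : nat -> A) x a : upd rho x a x = a.
Proof. by rewrite /upd eqxx. Qed.

Lemma map_upd (A : Type) (rho : nat -> A) x a (s : seq nat) :
  x \notin s -> map (upd rho x a) s = map rho s.
Proof.
move=> xs; apply/eq_in_map => y ys; apply: upd_neq.
by apply: contraNneq xs => <-.
Qed.

Lemma mem_free_FEx x phi y :
  (y \in free_names (FEx x phi)) = (y != x) && (y \in free_names phi).
Proof. exact: mem_filter. Qed.

Lemma mem_free_FAnd phi psi y : (y \in free_names (FAnd phi psi)) =
  (y \in free_names phi) || (y \in free_names psi).
Proof. exact: mem_cat. Qed.

Lemma mem_free_FNot phi y :
  (y \in free_names (FNot phi)) = (y \in free_names phi).
Proof. by []. Qed.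

Lemma mem_free_FLt x z y : (y \in free_names (FLt x z)) = (y == x) || (y == z).
Proof. by rewrite !inE. Qed.

Lemma mem_free_FZero x y : y \in free_names (FZero x) -> y == x.
Proof.
rewrite mem_free_FNot mem_free_FEx mem_free_FLt.
by case: (y == x.+1) => //=.
Qed.

Lemma mem_free_FSucc x z y :
  y \in free_names (FSucc x z) -> (y == x) || (y == z).
Proof.
rewrite mem_free_FAnd mem_free_FLt => /orP[//|].
rewrite mem_free_FNot mem_free_FEx mem_free_FAnd !mem_free_FLt.
by case: (y == x); case: (y == z) => //=; case: (y == _).
Qed.

Lemma free_names_FStep x phi y :
  y \in free_names (FStep x phi) -> (y == x) || (y \in free_names phi).
Proof.
rewrite mem_free_FEx mem_free_FAnd mem_free_FEx mem_free_FAnd.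
move=> /andP[yx /orP[/mem_free_FSucc|/andP[_ /orP[|->]]]]; last by rewrite orbT.
  by rewrite (negPf yx) orbF => ->.
by rewrite !inE (negPf yx) orbF => ->.
Qed.

Lemma free_names_iter_FStep x n phi y :
  y \in free_names (iter n (FStep x) phi) -> (y == x) || (y \in free_names phi).
Proof.
by elim: n => [->|n IH /free_names_FStep/orP[->//|/IH]] //; rewrite orbT.
Qed.

(** Closedness leaves only relation variables free in the compiled expression and makes satisfaction
    independent of the assignment. *)
Lemma free_names_FInput n m phi : {subset free_names phi <= [:: 0; 2]} ->
  free_names (FInput n m phi) = [::].
Proof.
move=> sub; have none y : y \notin free_names (FInput n m phi).
  have o0 : free_names FOrder = [::] by [].
  rewrite /FInput mem_free_FAnd o0 [_ || _]orFb mem_free_FEx mem_free_FAnd.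
  apply/negP => /andP[y0].
  move=> /orP[/mem_free_FZero|/free_names_iter_FStep]; rewrite (negPf y0) // orFb.
  rewrite mem_free_FEx mem_free_FAnd => /andP[y2].
  move=> /orP[/mem_free_FZero|/free_names_iter_FStep]; rewrite (negPf y2) // orFb.
  by move=> /sub; rewrite !inE (negPf y0) (negPf y2).
by case: (free_names _) none => // y ys /(_ y); rewrite mem_head.
Qed.

Lemma free_names_FAccepts f : {subset free_names (FAccepts f) <= [:: 0; 2]}.
Proof.
have none : free_names (FFactsJustified f 2) = [::].
  rewrite free_names_FAnds -map_comp (@eq_map _ _ _ (fun=> [::])); last first.
    by move=> p; apply: free_names_closure.
  by elim: (subcalls f 2).
by move=> y; rewrite mem_free_FAnd none.
Qed.

(** * Satisfaction in a finite linear order, with positions for individuals *)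

Section LinearModel.

Variables (A : eqType) (a0 : A) (l : seq A) (R : nat -> seq A -> bool).
Hypothesis l_uniq : uniq l.
Hypothesis R_lt : forall i j, i < size l -> j < size l ->
  R 1 [:: nth a0 l i; nth a0 l j] = (i < j).

Definition nsat (nu : nat -> nat) (phi : form) : bool :=
  sat l R (fun x => nth a0 l (nu x)) phi.

Definition bounded (nu : nat -> nat) : Prop := forall x, nu x < size l.

Lemma bounded_upd nu x v : bounded nu -> v < size l -> bounded (upd nu x v).
Proof. by move=> H lv y; rewrite /upd; case: eqP. Qed.

Lemma nsat_FEx nu x phi :
  nsat nu (FEx x phi) <-> exists2 v, v < size l & nsat (upd nu x v) phi.
Proof.
have E v : sat l R (upd (fun y => nth a0 l (nu y)) x (nth a0 l v)) phi =
           nsat (upd nu x v) phi.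
  by apply: eq_sat => y; rewrite /upd; case: eqP.
split=> [/hasP[a /(nthP a0)[v lv <-]]|[v lv H]].
  by move=> H; exists v => //; rewrite -E.
by apply/hasP; exists (nth a0 l v); [exact: mem_nth|move: H; rewrite -E].
Qed.

Lemma nsat_FAnd nu phi psi : nsat nu (FAnd phi psi) = nsat nu phi && nsat nu psi.
Proof. by []. Qed.

Lemma nsat_FOr nu phi psi : nsat nu (FOr phi psi) = nsat nu phi || nsat nu psi.
Proof. exact: sat_FOr. Qed.

Lemma nsat_FImp nu phi psi : nsat nu (FImp phi psi) = (nsat nu phi ==> nsat nu psi).
Proof. exact: sat_FImp. Qed.

Lemma nsat_FNot nu phi : nsat nu (FNot phi) = ~~ nsat nu phi.
Proof. by []. Qed.

Lemma nsat_FExs nu xs phi :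
  nsat nu (FExs xs phi) <->
  exists nu', [/\ {in [predC xs], nu' =1 nu},
    {in xs, forall x, nu' x < size l} & nsat nu' phi].
Proof.
split=> [/sat_FExs[rho [E D H]]|[nu' [E D H]]].
  exists (fun x => if x \in xs then index (rho x) l else nu x); split.
  - by move=> x; rewrite inE /= => /negPf ->.
  - by move=> x xin; rewrite xin index_mem D.
  - rewrite /nsat (@eq_sat _ _ _ _ rho) // => x; case: ifP => [/D xin|xout].
      exact: nth_index.
    by rewrite E // inE /= xout.
apply/sat_FExs; exists (fun x => nth a0 l (nu' x)); split=> //.
- by move=> x xin; rewrite E.
- by move=> x xin; apply/mem_nth/D.
Qed.

Lemma nsat_FAll nu x phi :
  nsat nu (FAll x phi) <-> forall v, v < size l -> nsat (upd nu x v) phi.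
Proof.
rewrite nsat_FNot; split=> [/negP H v lv|H].
  by apply: contraT => Hv; case: H; apply/nsat_FEx; exists v.
by apply/negP => /nsat_FEx[v lv]; rewrite nsat_FNot H.
Qed.

Lemma nsat_FEq nu x y : bounded nu -> nsat nu (FEq x y) = (nu x == nu y).
Proof. by move=> b; rewrite /nsat /= nth_uniq. Qed.

Lemma nsat_FLt nu x y : bounded nu -> nsat nu (FLt x y) = (nu x < nu y).
Proof. by move=> b; rewrite /nsat /= R_lt. Qed.

Lemma nsat_FZero nu x : bounded nu -> nsat nu (FZero x) = (nu x == 0).
Proof.
move=> b; have xx : x != x.+1 by lia.
have l0 : 0 < size l by apply: leq_ltn_trans (b x).
rewrite nsat_FNot; apply/negP/eqP => [H|x0].
  apply/eqP; rewrite -leqn0 leqNgt; apply/negP => nx; case: H.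
  apply/nsat_FEx; exists 0; rewrite // nsat_FLt ?upd_eq ?upd_neq //.
  exact: bounded_upd.
move=> /nsat_FEx[v lv]; rewrite nsat_FLt; last exact: bounded_upd.
by rewrite upd_eq upd_neq // x0.
Qed.

Lemma nsat_FSucc nu x y : bounded nu ->
  nsat nu (FSucc x y) = (nu y == (nu x).+1).
Proof.
move=> b; set z := (x + y).+1.
have [xz yz] : x != z /\ y != z by rewrite /z; split; lia.
have E : nsat nu (FEx z (FAnd (FLt x z) (FLt z y))) <->
         exists2 v, v < size l & nu x < v < nu y.
  have E v : v < size l ->
      nsat (upd nu z v) (FAnd (FLt x z) (FLt z y)) = (nu x < v < nu y).
    move=> lv; have bv := bounded_upd z b lv.
    have := nsat_FLt x z bv; have := nsat_FLt z y bv; rewrite /nsat /= => -> ->.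
    by rewrite upd_eq !upd_neq.
  split=> [/nsat_FEx[v lv]|[v lv H]]; first by rewrite E //; exists v.
  by apply/nsat_FEx; exists v; rewrite ?E.
have -> : nsat nu (FSucc x y) =
    nsat nu (FLt x y) && ~~ nsat nu (FEx z (FAnd (FLt x z) (FLt z y))) by [].
rewrite nsat_FLt //; apply/andP/eqP => [[lt /negP H]|Ey].
  (* Otherwise the position [(nu x).+1] lies strictly in between. *)
  apply/eqP; rewrite eqn_leq lt andbT leqNgt; apply/negP => lt'; apply: H.
  by apply/E; exists (nu x).+1; rewrite ?lt' ?ltnSn // (ltn_trans lt').
by rewrite Ey; split=> //; apply/negP => /E[v _]; rewrite Ey; lia.
Qed.

(** The bound excludes positions past the end of [l], which [nth] would read as [a0]. *)
Definition model_fact f s r : Prop :=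
  all (fun v => v < size l) (r :: s) /\
  R (fact_rel f (size s)) (map (nth a0 l) (r :: s)).

Lemma nsat_FFact nu f r xs : bounded nu ->
  nsat nu (FFact f r xs) <-> model_fact f (map nu xs) (nu r).
Proof.
move=> b; rewrite /nsat /model_fact /FFact /= size_map -map_comp.
split=> [H|[]//]; split=> //; rewrite b /=.
by apply/allP => _ /mapP[x _ ->].
Qed.

Lemma nsat_FNth nu i k y : bounded nu ->
  nsat nu (FNth i k y) = (nu y == nth 0 (map nu (iota 1 k)) i).
Proof.
move=> b; rewrite /FNth; case: ltnP => ki.
  by rewrite nsat_FEq // (nth_map 0) ?size_iota // nth_iota.
by rewrite nsat_FZero // nth_default // size_map size_iota.
Qed.

(** Every number in a justification occurs in some fact or is at most the value [nu 0], hence is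
    below [size l]: quantifying over the domain loses no witness. *)
Lemma nsat_FJustified nu f k : bounded nu ->
  nsat nu (FJustified f k) <->
  justified model_fact f (map nu (iota 1 k)) (nu 0).
Proof.
move=> b; have notin n x m : m + n <= x -> x \notin iota m n.
  by rewrite mem_iota => le; apply/negP; lia.
case: f => [||i|f gs|f g|f] /=.
- by rewrite nsat_FZero //; split=> /eqP.
- split=> [/nsat_FEx[v lv]|E].
    rewrite nsat_FAnd nsat_FNth ?nsat_FSucc; try exact: bounded_upd.
    by rewrite upd_eq upd_neq // map_upd ?notin // => /andP[/eqP -> /eqP].
  have lv : nth 0 (map nu (iota 1 k)) 0 < size l.
    by rewrite (ltn_trans _ (b 0)) // E.
  apply/nsat_FEx; exists (nth 0 (map nu (iota 1 k)) 0) => //.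
  rewrite nsat_FAnd nsat_FNth ?nsat_FSucc; try exact: bounded_upd.
  by rewrite upd_eq upd_neq // map_upd ?notin // eqxx /= E.
- by rewrite nsat_FNth //; split=> /eqP.
- have step nu' : {in [predC iota k.+1 (size gs)], nu' =1 nu} -> bounded nu' ->
      nsat nu' (FAnd (FFact f 0 (iota k.+1 (size gs)))
        (FAnds [seq FFact (nth MuZero gs i) (k.+1 + i) (iota 1 k)
               | i <- iota 0 (size gs)])) <->
      model_fact f (map nu' (iota k.+1 (size gs))) (nu 0) /\
      forall i, i < size gs ->
        model_fact (nth MuZero gs i) (map nu (iota 1 k))
          (nth 0 (map nu' (iota k.+1 (size gs))) i).
    move=> E b'.
    have E0 : nu' 0 = nu 0 by apply: E; rewrite inE /= mem_iota.
    have Ea : map nu' (iota 1 k) = map nu (iota 1 k).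
      apply/eq_in_map => x; rewrite mem_iota => xin; apply: E.
      by rewrite inE /= mem_iota; apply/negP; lia.
    have Ei i : i < size gs -> nth 0 (map nu' (iota k.+1 (size gs))) i = nu' (k.+1 + i).
      by move=> lti; rewrite (nth_map 0) ?size_iota // nth_iota.
    rewrite nsat_FAnd {2}/nsat sat_FAnds all_map; split.
      move=> /andP[/nsat_FFact H1 /allP H2]; split; first by rewrite -E0; apply: H1.
      move=> i lti; rewrite Ei // -Ea; apply/nsat_FFact => //; apply: H2.
      by rewrite mem_iota.
    move=> [H1 H2]; apply/andP; split; first by apply/nsat_FFact; rewrite ?E0.
    apply/allP => i; rewrite mem_iota => /= lti.
    by apply/nsat_FFact => //; rewrite Ea -Ei //; apply: H2.
  split=> [/nsat_FExs[nu' [E D]]|[vs [szv Hf Hg]]].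
    have b' : bounded nu'.
      move=> x; case: (boolP (x \in iota k.+1 (size gs))) => [/D//|xout].
      by rewrite E.
    move=> /(step _ E b')[H1 H2]; exists (map nu' (iota k.+1 (size gs))).
    by rewrite size_map size_iota.
  (* The values of the inner functions take the names from [k.+1] on, just after those of the
     arguments. *)
  pose nu' x := if x \in iota k.+1 (size gs) then nth 0 vs (x - k.+1) else nu x.
  have E : {in [predC iota k.+1 (size gs)], nu' =1 nu}.
    by move=> x; rewrite inE /nu' /= => /negPf ->.
  have b' : bounded nu'.
    move=> x; rewrite /nu'; case: ifP => //; rewrite mem_iota => xin.
    by have [/= /andP[_ /(all_nthP 0) Hv] _] := Hf; apply: Hv; rewrite szv; lia.
  have Ev : map nu' (iota k.+1 (size gs)) = vs.
    apply: (@eq_from_nth _ 0); rewrite size_map size_iota // => i lti.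
    rewrite (nth_map 0) ?size_iota // nth_iota // /nu' mem_iota ifT; last by lia.
    by rewrite addKn.
  apply/nsat_FExs; exists nu'; split=> //.
  by apply/step => //; rewrite Ev.
- case: k => [|k]; first by split=> //; rewrite nsat_FNot /nsat sat_FTrue.
  rewrite [map _ _]/=; set s := map nu (iota 2 k).
  have step u v : u < size l -> v < size l ->
      nsat (upd (upd nu k.+2 u) k.+3 v) (FAnd (FSucc k.+2 1)
        (FAnd (FFact (MuPrec f g) k.+3 (k.+2 :: iota 2 k))
           (FFact g 0 [:: k.+2, k.+3 & iota 2 k]))) <->
      [/\ nu 1 = u.+1, model_fact (MuPrec f g) (u :: s) v &
        model_fact g [:: u, v & s] (nu 0)].
    move=> lu lv; set nu' := upd _ _ _.
    have b' : bounded nu' by do 2!apply: bounded_upd => //.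
    have Es : map nu' (iota 2 k) = s by rewrite /nu' !map_upd ?notin.
    have E0 : nu' 0 = nu 0 by rewrite /nu' !upd_neq.
    have E1 : nu' 1 = nu 1 by rewrite /nu' !upd_neq.
    have E2 : nu' k.+2 = u by rewrite /nu' upd_neq ?upd_eq //; apply/eqP; lia.
    have E3 : nu' k.+3 = v by rewrite /nu' upd_eq.
    rewrite nsat_FAnd nsat_FSucc // nsat_FAnd E1 E2; split.
      move=> /and3P[/eqP -> /nsat_FFact H1 /nsat_FFact H2].
      by split=> //; [move: (H1 b')|move: (H2 b')]; rewrite /= Es ?E0 E2 E3.
    move=> [-> H1 H2]; rewrite eqxx andTb; apply/andP; split;
      by apply/nsat_FFact; rewrite //= Es ?E0 E2 E3.
  rewrite nsat_FOr nsat_FAnd nsat_FZero //; split.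
    case/orP=> [/andP[/eqP -> /nsat_FFact]|]; first exact.
    move=> /nsat_FEx[u lu /nsat_FEx[v lv]].
    by move=> /step[] // -> H1 H2; exists v.
  case E1: (nu 1) => [|u] H.
    by rewrite eqxx; apply/orP; left; apply/nsat_FFact.
  apply/orP; right; case: H => v [H1 H2].
  have lu : u < size l by apply: ltnW; rewrite -E1.
  have lv : v < size l by case: H1 => /andP[].
  by apply/nsat_FEx; exists u => //; apply/nsat_FEx; exists v => //; apply/step.
- set s := map nu (iota 1 k).
  have notin1 n : k.+1 + n \notin iota 1 k by apply: notin; lia.
  have E1 v : v < size l ->
      nsat (upd nu k.+1 v) (FAnd (FZero k.+1) (FFact f k.+1 (0 :: iota 1 k))) <->
      v = 0 /\ model_fact f (nu 0 :: s) v.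
    move=> lv; have b' := bounded_upd k.+1 b lv.
    rewrite nsat_FAnd nsat_FZero // upd_eq.
    split=> [/andP[/eqP -> /nsat_FFact H]|[-> H]].
      split=> //; have := H (bounded_upd k.+1 b (leq_ltn_trans (leq0n _) lv)).
      by rewrite /= upd_eq upd_neq // map_upd // -[k.+1]addn0.
    apply/nsat_FFact; first by apply: bounded_upd => //; exact: leq_ltn_trans lv.
    by rewrite /= upd_eq upd_neq // map_upd // -[k.+1]addn0.
  have E2 u v : u < size l -> v < size l ->
      nsat (upd (upd nu k.+1 u) k.+2 v)
        (FAnd (FNot (FZero k.+2)) (FFact f k.+2 (k.+1 :: iota 1 k))) <->
      0 < v /\ model_fact f (u :: s) v.
    move=> lu lv; set nu' := upd _ _ _.
    have b' : bounded nu' by do 2!apply: bounded_upd => //.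
    have Es : map nu' (iota 1 k) = s by rewrite /nu' !map_upd ?notin.
    have E2 : nu' k.+1 = u by rewrite /nu' upd_neq ?upd_eq //; apply/eqP; lia.
    have E3 : nu' k.+2 = v by rewrite /nu' upd_eq.
    rewrite nsat_FAnd nsat_FNot nsat_FZero // E3 lt0n; split.
      by move=> /andP[-> /nsat_FFact]; rewrite /= Es E2 E3; split=> //; auto.
    by move=> [-> H]; apply/nsat_FFact; rewrite //= Es E2 E3.
  rewrite nsat_FAnd; split.
    move=> /andP[/nsat_FEx[v lv HE] /nsat_FAll H]; have [v0 H0] := (E1 v lv).1 HE.
    subst v; split=> //.
    move=> i lti; have li : i < size l by apply: ltn_trans (b 0).
    have := H i li; rewrite nsat_FImp nsat_FLt; last exact: bounded_upd.
    rewrite upd_eq upd_neq // lti implyTb => /nsat_FEx[w lw Hw].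
    by have [] := (E2 i w li lw).1 Hw; case: w {lw Hw} => // w _ Hw; exists w.
  move=> [H0 H]; apply/andP; split.
    have l0 : 0 < size l by apply: leq_ltn_trans (b 0).
    by apply/nsat_FEx; exists 0 => //; apply/E1.
  apply/nsat_FAll => i li; rewrite nsat_FImp nsat_FLt; last exact: bounded_upd.
  rewrite upd_eq upd_neq //; apply/implyP => /H[w Hw].
  have lw : w.+1 < size l by case: Hw => /andP[].
  by apply/nsat_FEx; exists w.+1 => //; apply/E2.
Qed.

Lemma nsat_FFactsJustified nu f k : 0 < size l ->
  nsat nu (FFactsJustified f k) <->
  (forall h s r, (h, size s) \in subcalls f k -> model_fact h s r ->
     justified model_fact h s r).
Proof.
move=> l0; rewrite /nsat sat_FAnds all_map; split.
  move=> /allP H h s r hin Fh; have /sat_closure Hc := H _ hin.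
  (* The list [r :: s] is read as an assignment: name 0 gets the value, the next names the
     arguments, and all further names 0. *)
  have b : bounded (nth 0 (r :: s)).
    move=> x; case: (ltnP x (size (r :: s))) => [ltx|lex]; last by rewrite nth_default.
    by case: Fh => /(all_nthP 0)/(_ x ltx).
  have : nsat (nth 0 (r :: s))
      (FImp (FFact h 0 (iota 1 (size s))) (FJustified h (size s))).
    by apply: Hc => x _; apply: mem_nth.
  rewrite nsat_FImp => /implyP HF.
  have Es : map (nth 0 (r :: s)) (iota 1 (size s)) = s.
    apply: (@eq_from_nth _ 0); rewrite size_map size_iota // => i lti.
    by rewrite (nth_map 0) ?size_iota // nth_iota.
  have /HF/nsat_FJustified : nsat (nth 0 (r :: s)) (FFact h 0 (iota 1 (size s))).
    by apply/nsat_FFact; rewrite ?Es.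
  by rewrite Es; apply.
move=> H; apply/allP => -[h n] hin.
pose phi := FImp (FFact h 0 (iota 1 n)) (FJustified h n).
suff Hphi rho : sat l R rho (universal_closure phi) by apply: Hphi.
apply/sat_closure => {}rho D.
(* Outside the free names [rho] may leave [l]; any position will do there. *)
pose nu' x := if x \in free_names phi then index (rho x) l else 0.
have b : bounded nu' by move=> x; rewrite /nu'; case: ifP => // /D; rewrite index_mem.
rewrite (@eq_in_sat _ _ _ _ (fun x => nth a0 l (nu' x))); last first.
  by move=> x xin; rewrite /nu' xin nth_index // D.
rewrite -/(nsat nu' phi) nsat_FImp; apply/implyP => /nsat_FFact HF.
apply/nsat_FJustified => //; apply: H; last exact: HF.
by rewrite size_map size_iota.
Qed.

Lemma nsat_FStep nu x phi : bounded nu ->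
  nsat nu (FStep x phi) <->
  (nu x).+1 < size l /\ nsat (upd (upd nu x.+1 (nu x).+1) x (nu x).+1) phi.
Proof.
move=> b; have [xx xx'] : x != x.+1 /\ x.+1 != x by split; lia.
have E u v : u < size l -> v < size l ->
    nsat (upd (upd nu x.+1 u) x v) (FAnd (FEq x x.+1) phi) =
    (v == u) && nsat (upd (upd nu x.+1 u) x v) phi.
  move=> lu lv; rewrite nsat_FAnd nsat_FEq; last by do 2!apply: bounded_upd => //.
  by rewrite upd_eq upd_neq // upd_eq.
split=> [/nsat_FEx[u lu]|[lx H]].
  rewrite nsat_FAnd nsat_FSucc; last exact: bounded_upd.
  rewrite upd_eq upd_neq // => /andP[/eqP Eu /nsat_FEx[v lv]].
  by rewrite E // => /andP[/eqP Ev]; rewrite -Eu Ev.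
apply/nsat_FEx; exists (nu x).+1 => //.
rewrite nsat_FAnd nsat_FSucc; last exact: bounded_upd.
rewrite upd_eq upd_neq // eqxx; apply/nsat_FEx; exists (nu x).+1 => //.
by rewrite E // eqxx.
Qed.

(** The final value of the scratch name [x.+1] is left unspecified; the converse below accordingly
    asks for [phi] whatever that value is. *)
Lemma nsat_iter_FStep nu x n phi : bounded nu -> nsat nu (iter n (FStep x) phi) ->
  exists nu', [/\ forall y, y != x -> y != x.+1 -> nu' y = nu y, bounded nu',
    nu' x = nu x + n & nsat nu' phi].
Proof.
elim: n nu => [|n IH] nu b; first by exists nu; rewrite addn0.
move=> /nsat_FStep[]// lx /IH[].
  by do 2!apply: bounded_upd => //.
move=> nu' [E b' Ex H]; exists nu'; split=> // [y yx yx'|].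
  by rewrite E // !upd_neq.
by rewrite Ex upd_eq addSnnS.
Qed.

Lemma iter_FStep_nsat nu x n phi : bounded nu -> nu x + n < size l ->
  (forall nu', (forall y, y != x -> y != x.+1 -> nu' y = nu y) -> bounded nu' ->
    nu' x = nu x + n -> nsat nu' phi) ->
  nsat nu (iter n (FStep x) phi).
Proof.
elim: n nu => [|n IH] nu b lx H; first by apply: H; rewrite ?addn0.
have lx' : (nu x).+1 < size l by apply: leq_ltn_trans lx; lia.
have b' : bounded (upd (upd nu x.+1 (nu x).+1) x (nu x).+1).
  by do 2!apply: bounded_upd => //.
apply/nsat_FStep => //; split=> //; apply: IH => //.
  by rewrite upd_eq addSnnS.
move=> nu' E b'' Ex; apply: H => // [y yx yx'|]; first by rewrite E // !upd_neq.
by rewrite Ex upd_eq addSnnS.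
Qed.

Lemma nsat_FAccepts nu f : bounded nu ->
  nsat nu (FAccepts f) <->
  [/\ model_fact f [:: nu 0; nu 2] 1 &
    forall h s r, (h, size s) \in subcalls f 2 -> model_fact h s r ->
      justified model_fact h s r].
Proof.
move=> b; have l0 : 0 < size l by apply: leq_ltn_trans (b 0).
have E v : v < size l ->
    nsat (upd nu 4 v)
      (FAnd (FEx 5 (FAnd (FZero 5) (FSucc 5 4))) (FFact f 4 [:: 0; 2])) <->
    v = 1 /\ model_fact f [:: nu 0; nu 2] v.
  move=> lv; have b' := bounded_upd 4 b lv; rewrite nsat_FAnd.
  have E5 w : w < size l -> nsat (upd (upd nu 4 v) 5 w) (FAnd (FZero 5) (FSucc 5 4)) =
      (w == 0) && (v == w.+1).
    move=> lw; rewrite nsat_FAnd nsat_FZero ?nsat_FSucc; try exact: bounded_upd.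
    by rewrite upd_eq upd_neq.
  split=> [/andP[/nsat_FEx[w lw]]|[v1 H]].
    rewrite E5 // => /andP[/eqP -> /eqP ?] /nsat_FFact H; subst v; split=> //.
    by apply: H; apply: bounded_upd.
  apply/andP; split; last by apply/nsat_FFact.
  by apply/nsat_FEx; exists 0; rewrite // E5 // v1.
rewrite nsat_FAnd; split.
  move=> /andP[/nsat_FFactsJustified H /nsat_FEx[v lv HE]].
  by have [v1 H1] := (E v lv).1 HE; subst v; split=> //; apply: H.
move=> [H1 H2]; apply/andP; split; first exact/nsat_FFactsJustified.
have l1 : 1 < size l by case: H1 => /andP[].
by apply/nsat_FEx; exists 1 => //; apply/E.
Qed.

End LinearModel.

(** * Finite models of the input formula and accepting evaluations *)

Lemma sat_FOrder_enum (A : eqType) (dom : seq A) R rho : sat dom R rho FOrder ->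
  exists l, [/\ uniq l, dom =i l &
    {in l &, forall a b, R 1 [:: a; b] = (index a l < index b l)}].
Proof.
have -> : sat dom R rho FOrder = [&& sat dom R rho FIrreflexive,
  sat dom R rho FTransitive & sat dom R rho FTotal] by [].
rewrite !sat_FAll => /and3P[/allP H1 /allP H2 /allP H3].
pose lt a b := R 1 [:: a; b].
have irr a : a \in dom -> lt a a = false by move=> /H1/negbTE.
have tr : {in dom & &, transitive lt}.
  move=> b a c bin ain cin ab bc.
  have := H2 a ain; rewrite sat_FAll => /allP/(_ b bin); rewrite sat_FAll.
  by move=> /allP/(_ c cin); rewrite sat_FImp => /implyP; apply; apply/andP.
have tot a b : a \in dom -> b \in dom -> [|| a == b, lt a b | lt b a].
  move=> ain bin; have := H3 a ain; rewrite sat_FAll => /allP/(_ b bin).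
  by rewrite !sat_FOr.
pose le a b := (a == b) || lt a b.
have le_tr : {in dom & &, transitive le}.
  move=> b a c bin ain cin; rewrite /le => /orP[/eqP ->//|ab] /orP[/eqP <-|bc].
    by rewrite ab orbT.
  by rewrite (tr b a c) ?orbT.
have le_tot : {in dom &, total le}.
  by move=> a b ain bin; rewrite /le; have /or3P[->|->|->] := tot a b ain bin;
    rewrite ?orbT.
(* [dom] may repeat individuals; once these are made distinct and sorted, the strict order is that
   of positions. *)
pose l := sort le (undup dom).
have lE : dom =i l by move=> a; rewrite mem_sort mem_undup.
have l_sorted : sorted le l.
  by apply: (sort_sorted_in le_tot); apply/allP => a; rewrite mem_undup.
have leI a b : a \in l -> b \in l -> index a l < index b l -> lt a b.
  move=> ain bin ab; have : le a b.
    apply: (sorted_ltn_index_in _ l_sorted) => // x y z.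
    by rewrite -!lE; apply: le_tr.
  by case/orP => // /eqP E; move: ab; rewrite E ltnn.
exists l; split=> //; first by rewrite sort_uniq undup_uniq.
move=> a b ain bin; apply/idP/idP; last exact: leI.
move=> ab; rewrite ltnNge leq_eqVlt; apply/negP => /orP[/eqP E|/leI H].
  have Eab : b = a by rewrite -(nth_index a bin) E nth_index.
  by move: ab; rewrite Eab -/(lt a a) irr // lE.
have := tr b a a; rewrite !lE irr ?lE // => /(_ bin ain ain ab).
by rewrite H // => /(_ isT).
Qed.

(** Whatever the relations contain, the facts about calls of [f] on two arguments are closed under
    justification, hence true by [justified_sound]. *)
Lemma FInput_sound (A : eqType) (dom : seq A) R rho f n m :
  sat dom R rho (FInput n m (FAccepts f)) -> mu_eval f [:: n; m] 1.
Proof.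
move=> H; have [HO H'] := andP H.
have [l [l_uniq El R_lt]] := sat_FOrder_enum HO.
(* The existential quantifier over the name 0 guarantees a nonempty domain. *)
have [a0 a0l] : exists a0, a0 \in l by case/hasP: H' => a; rewrite El; exists a.
have R_lt' i j : i < size l -> j < size l ->
    R 1 [:: nth a0 l i; nth a0 l j] = (i < j).
  by move=> li lj; rewrite R_lt ?mem_nth // !index_uniq.
have l0 : 0 < size l by rewrite lt0n size_eq0; apply: contraTneq a0l => ->.
pose nu0 (x : nat) := 0.
have b0 : bounded l nu0 by [].
have : nsat a0 l R nu0 (FInput n m (FAccepts f)).
  rewrite /nsat -(eq_sat_dom _ _ _ El) (@eq_in_sat _ _ _ _ rho) // => x.
  by rewrite free_names_FInput //; apply: free_names_FAccepts.
rewrite /FInput nsat_FAnd => /andP[_ /nsat_FEx[v lv]].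
have bv := bounded_upd 0 b0 lv; rewrite nsat_FAnd nsat_FZero // upd_eq.
move=> /andP[/eqP v0 /nsat_iter_FStep[]// nu1 [_ b1 E1 /nsat_FEx[w lw]]].
have bw := bounded_upd 2 b1 lw; rewrite nsat_FAnd nsat_FZero // upd_eq.
move=> /andP[/eqP w0 /nsat_iter_FStep[]// nu2 [E b2 E2 /nsat_FAccepts[]// HF HJ]].
have <- : nu2 0 = n by rewrite E // upd_neq // E1 upd_eq v0.
have <- : nu2 2 = m by rewrite E2 upd_eq w0.
exact: (justified_sound HJ).
Qed.

Lemma FInput_complete (A : eqType) (a0 : A) l R f n m rho :
  uniq l ->
  (forall i j, i < size l -> j < size l ->
     R 1 [:: nth a0 l i; nth a0 l j] = (i < j)) ->
  model_fact a0 l R f [:: n; m] 1 ->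
  (forall h s r, model_fact a0 l R h s r -> justified (model_fact a0 l R) h s r) ->
  sat l R rho (FInput n m (FAccepts f)).
Proof.
move=> l_uniq R_lt HF HJ.
have [l0 ln lm] : [/\ 0 < size l, n < size l & m < size l].
  by case: HF => /and4P[_ ln lm _] _; split=> //; apply: leq_ltn_trans ln.
pose nu0 (x : nat) := 0; have b0 : bounded l nu0 by [].
(* The formula is closed, so every name may start at position 0. *)
rewrite (@eq_in_sat _ _ _ _ (fun x => nth a0 l (nu0 x))); last first.
  by move=> x; rewrite free_names_FInput //; apply: free_names_FAccepts.
rewrite -/(nsat a0 l R nu0 _) /FInput nsat_FAnd; apply/andP; split.
  rewrite /FOrder !nsat_FAnd; apply/and3P; split.
  - apply/nsat_FAll => // i li; have b := bounded_upd 0 b0 li.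
    by rewrite nsat_FNot nsat_FLt // ltnn.
  - apply/nsat_FAll => // i li; have b := bounded_upd 0 b0 li.
    apply/nsat_FAll => // j lj; have b' := bounded_upd 1 b lj.
    apply/nsat_FAll => // k lk; have b'' := bounded_upd 2 b' lk.
    rewrite nsat_FImp nsat_FAnd !nsat_FLt //; apply/implyP => /andP[].
    exact: ltn_trans.
  - apply/nsat_FAll => // i li; have b := bounded_upd 0 b0 li.
    apply/nsat_FAll => // j lj; have b' := bounded_upd 1 b lj.
    by rewrite !nsat_FOr nsat_FEq // !nsat_FLt //; case: ltngtP.
apply/nsat_FEx => //; exists 0 => //; have b1 := bounded_upd 0 b0 l0.
rewrite nsat_FAnd nsat_FZero // upd_eq andTb.
apply: iter_FStep_nsat => // nu1 _ b1' E1.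
apply/nsat_FEx => //; exists 0 => //; have b2 := bounded_upd 2 b1' l0.
rewrite nsat_FAnd nsat_FZero // upd_eq andTb.
apply: iter_FStep_nsat => // nu2 E b2' E2.
apply/nsat_FAccepts => //; rewrite E2 E // upd_eq upd_neq // E1 upd_eq.
by split=> // h s r _; apply: HJ.
Qed.

(** * Codes of the instances and the reduction *)

(* Unification would otherwise evaluate the codes in unary. *)
Local Opaque cpair.

Lemma plug_cat cs cs' c : plug (cs ++ cs') c = plug cs (plug cs' c).
Proof. exact: foldr_cat. Qed.

Lemma plug_cons c cs c' : plug (c :: cs) c' = cpair c (plug cs c').
Proof. reflexivity. Qed.

(** The body of a loop comes last in its code, as does the second conjunct of a compiled
    conjunction, so nesting them concatenates contexts. *)
Definition ex_context (x : nat) : seq nat :=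
  [:: 8; cpair (ind_var x) (code_kind any_kind); code_expr (Var (rel_var 0))].

Lemma code_FEx x phi :
  code_expr (compile (FEx x phi)) = plug (ex_context x) (code_expr (compile phi)).
Proof. reflexivity. Qed.

Definition and_context (phi : form) : seq nat :=
  [:: 10; code_expr (compile phi); code_expr Empty].

Lemma code_FAnd phi psi : code_expr (compile (FAnd phi psi)) =
  plug (and_context phi) (code_expr (compile psi)).
Proof. reflexivity. Qed.

Definition step_context (x : nat) : seq nat :=
  ex_context x.+1 ++ and_context (FSucc x x.+1) ++
  ex_context x ++ and_context (FEq x x.+1).

Lemma code_FStep x phi : code_expr (compile (FStep x phi)) =
  plug (step_context x) (code_expr (compile phi)).
Proof.
by rewrite /FStep code_FEx code_FAnd code_FEx code_FAnd /step_context !plug_cat.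
Qed.

Lemma code_iter_FStep x n phi : code_expr (compile (iter n (FStep x) phi)) =
  iter n (plug (step_context x)) (code_expr (compile phi)).
Proof.
elim: n => [|n IH]; first reflexivity.
by rewrite [in LHS]iterS code_FStep IH -iterS.
Qed.

(** The leading 4 is the tag of [Name] in [code_expr]. *)
Definition outer_context : seq nat :=
  4 :: and_context FOrder ++ ex_context 0 ++ and_context (FZero 0).

Definition inner_context : seq nat := ex_context 2 ++ and_context (FZero 2).

(** [Name] turns truth into undefinedness: it is undefined on the lone atom that stands for true and
    defined on the empty value that stands for false. *)
Definition input_expr (n m : nat) (phi : form) : expr :=
  Name (compile (FInput n m phi)).

Lemma code_input_expr n m phi : code_expr (input_expr n m phi) =
  plug outer_context (iter n (plug (step_context 0)) (plug inner_context
    (iter m (plug (step_context 2)) (code_expr (compile phi))))).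
Proof.
have -> : code_expr (input_expr n m phi) =
  cpair 4 (code_expr (compile (FInput n m phi))) by [].
rewrite /FInput code_FAnd code_FEx code_FAnd code_iter_FStep code_FEx code_FAnd.
rewrite code_iter_FStep /inner_context plug_cat /outer_context.
by rewrite plug_cons !plug_cat.
Qed.

Lemma max_arity_iter_FStep x n phi :
  max_arity (iter n (FStep x) phi) <= maxn 2 (max_arity phi).
Proof.
elim: n => [|n IH]; first exact: leq_maxr.
by rewrite iterS /=; lia.
Qed.

Lemma max_arity_FInput n m phi :
  max_arity (FInput n m phi) <= maxn 2 (max_arity phi).
Proof.
have H0 := max_arity_iter_FStep 2 m phi.
have := max_arity_iter_FStep 0 n (FEx 2 (FAnd (FZero 2) (iter m (FStep 2) phi))).
by rewrite /=; lia.
Qed.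

Lemma rel_ind_var j x : (rel_var j == ind_var x) = false.
Proof. by apply/negbTE; rewrite /rel_var /ind_var; lia. Qed.

Lemma rel_var_inj : injective rel_var.
Proof. by move=> i j; rewrite /rel_var; lia. Qed.

(** A relation applied to no names compiles to [tt_expr] and leaves no variable, whereas every
    quantifier mentions relation 0. *)
Fixpoint uses_rel (j : nat) (phi : form) : bool :=
  match phi with
  | FEq _ _ => false
  | FRel i xs => (j == i) && ~~ nilp xs
  | FNot phi => uses_rel j phi
  | FAnd phi psi => uses_rel j phi || uses_rel j psi
  | FEx _ phi => (j == 0) || uses_rel j phi
  end.

Lemma rel_var_fv j phi : (rel_var j \in fv (compile phi)) = uses_rel j phi.
Proof.
elim: phi => [x y|i [|x xs]|phi IH|phi IHp psi IHq|x phi IH].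
- by rewrite /= !inE !rel_ind_var.
- by rewrite [uses_rel _ _]andbF.
- rewrite -[compile _]/(path_expr (Var (rel_var i)) (x :: xs)) [uses_rel _ _]andbT.
  apply/idP/eqP => [/fv_path_expr[|[z _ /eqP]]|->].
  + by rewrite in_fset1 (inj_eq rel_var_inj) => /eqP.
  + by rewrite rel_ind_var.
  + have [/fsubsetP sub _] := mem_path_expr (Var (rel_var i)) x xs.
    by apply: sub; rewrite in_fset1.
- by rewrite [fv _]/= !fsetU0.
- by rewrite [fv _]/= fsetU0 in_fsetU IHp IHq.
- by rewrite [fv _]/= in_fsetU in_fsetD !in_fset1 rel_ind_var (inj_eq rel_var_inj) IH.
Qed.

Lemma eq_sat_rel (A : eqType) (dom : seq A) R R' rho phi :
  (forall j, R j [::] = R' j [::]) ->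
  (forall j, uses_rel j phi -> R j =1 R' j) ->
  sat dom R rho phi = sat dom R' rho phi.
Proof.
move=> E0; elim: phi rho => [x y|i [|x xs]|phi IH|phi IHp psi IHq|x phi IH] rho E //=.
- by rewrite (E i) //= eqxx.
- by rewrite IH.
- by rewrite IHp 1?IHq // => j ju; apply: E; rewrite /= ju ?orbT.
- by apply: eq_has => a; apply: IH => j ju; apply: E; rewrite /= ju orbT.
Qed.

Lemma uses_rel_iter_FStep j x n phi :
  uses_rel j.+2 (iter n (FStep x) phi) = uses_rel j.+2 phi.
Proof. by elim: n. Qed.

Lemma uses_rel_FInput j n m phi :
  uses_rel j (FInput n m phi) = (j < 2) || uses_rel j phi.
Proof.
case: j => [|[|j]] //; rewrite -(uses_rel_iter_FStep j 2 m phi).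
exact: (uses_rel_iter_FStep j 0 n (FEx 2 (FAnd (FZero 2) (iter m (FStep 2) phi)))).
Qed.

Local Opaque compile.

Lemma fv_input_expr n m phi :
  fv (input_expr n m phi) = fv (compile (FInput n m phi)).
Proof. by []. Qed.

Lemma fv_input_expr_rel n m f y : y \in fv (input_expr n m (FAccepts f)) ->
  exists j, y = rel_var j.
Proof.
rewrite fv_input_expr => /fv_compile[//|[x]].
rewrite free_names_FInput //.
exact: free_names_FAccepts.
Qed.

(** Thanks to this, the type assignment is determined by [f] alone, and its own code can then be
    taken for [m]. *)
Lemma fv_input_expr_const n m n' m' f :
  fv (input_expr n m (FAccepts f)) = fv (input_expr n' m' (FAccepts f)).
Proof.
apply/fsetP => y; apply/idP/idP => yin; have [j Ey] := fv_input_expr_rel yin;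
  by move: yin; rewrite Ey !fv_input_expr !rel_var_fv !uses_rel_FInput.
Qed.

(** 2 covers the words of the order, [max_arity] the words that the formula tests, and
    [(call_width f 2).+1] the stored facts, each being a value followed by arguments. *)
Definition input_depth (f : murec) : nat :=
  maxn 2 (maxn (max_arity (FAccepts f)) (call_width f 2).+1).

Definition input_assignment (f : murec) : type_assignment :=
  [fmap y : fv (input_expr 0 0 (FAccepts f)) => trie_rxtype (input_depth f)].

Lemma fnd_input_assignment f y :
  (input_assignment f).[? y]%fmap =
  if y \in fv (input_expr 0 0 (FAccepts f)) then Some (trie_rxtype (input_depth f))
  else None.
Proof.
case: ifP => yin; last by rewrite not_fnd //= yin.
by rewrite in_fnd ffunE.
Qed.

(** * Ill-definedness of the input expression and acceptance *)

Section Reduction.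

Variables (atom : countType) (content : atom -> {fset node atom} -> atom)
  (concat : {fset atom} -> atom).
Hypothesis atom_infinite : forall A : {fset atom}, exists a : atom, a \notin A.

Lemma uniq_atoms n : exists l : seq atom, uniq l /\ size l = n.
Proof.
elim: n => [|n [l [ul sl]]]; first by exists [::].
have [a al] := atom_infinite [fset x in l].
by exists (a :: l); rewrite /= sl ul andbT; move: al; rewrite inE.
Qed.

(** An unbound relation still holds of the empty word, as [eval_compile] requires. *)
Definition env_rel (s : env atom) (j : nat) (t : seq atom) : bool :=
  if s.[? rel_var j]%fmap is Some v then has_path v t else nilp t.

Definition env_dom (s : env atom) : seq atom :=
  if s.[? rel_var 0]%fmap is Some v then map (@item_label atom) v else [::].

Lemma eval_input_expr (s : env atom) n m f a0 :
  env_in s (input_assignment f) ->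
  eval content concat s (input_expr n m (FAccepts f)) =
  if sat (env_dom s) (env_rel s) (fun=> a0) (FInput n m (FAccepts f))
  then None else Some (atom_value (concat fset0)).
Proof.
move=> [ds ts]; set phi := FInput _ _ _.
have bind j : rel_var j \in fv (compile phi) ->
    rel_binding s (input_depth f) (rel_var j) (env_rel s j).
  move=> jin; have jin0 : rel_var j \in fv (input_expr 0 0 (FAccepts f)).
    by rewrite (fv_input_expr_const 0 0 n m).
  have jd : rel_var j \in domf s by rewrite ds.
  exists s.[jd]%fmap; split; first exact: in_fnd.
    by apply: ts (in_fnd jd) _; rewrite fnd_input_assignment jin0.
  by move=> t; rewrite /env_rel in_fnd.
have E := @eval_compile atom content concat (input_depth f) (env_dom s) (env_rel s)
  phi s (fun=> a0).
rewrite /input_expr [LHS]/= E {E} //.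
- by case: (sat _ _ _ _); rewrite /= /name /truth ?/atom_value -?fset_seq1.
- by rewrite /input_depth; lia.
- apply: leq_trans (max_arity_FInput _ _ _) _.
  by rewrite /input_depth; lia.
- by move=> j; rewrite /env_rel; case: fndP.
- move=> a; have [|v [Ev _ _]] := bind 0; first by rewrite rel_var_fv uses_rel_FInput.
  rewrite /env_dom /env_rel Ev /=; apply/mapP/hasP => [[i iin ->]|[i iin]].
    by exists i; rewrite // eqxx.
  by rewrite andbT => /eqP <-; exists i.
- move=> x /(@fv_input_expr_rel n m f _)[j /eqP].
  by rewrite eq_sym rel_ind_var.
Qed.

Lemma input_expr_defined n m f :
  ~ mu_eval f [:: n; m] 1 ->
  well_defined content concat (input_expr n m (FAccepts f), input_assignment f).
Proof.
move=> H s sG; have [a0 _] := atom_infinite fset0.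
rewrite (eval_input_expr n m a0 sG).
case: ifP => [/FInput_sound/H//|_]; by eexists.
Qed.

Lemma prefix_same_size (T : eqType) (t u : seq T) :
  prefix t u -> size t = size u -> t = u.
Proof.
move=> /prefixP[w Ew]; rewrite Ew size_cat => /eqP.
by rewrite -[X in X == _]addn0 eqn_add2l eq_sym size_eq0 => /eqP ->; rewrite cats0.
Qed.

Definition fact_tries (l : seq atom) (a0 : atom) (D : seq fact) (j : nat) :
    seq (seq atom) :=
  match j with
  | 0 => [seq [:: a] | a <- l]
  | 1 => [seq [:: a; b] | a <- l, b <- [seq b <- l | index a l < index b l]]
  | j => [seq map (nth a0 l) (d.2 :: d.1.2)
         | d <- D & fact_rel d.1.1 (size d.1.2) == j]
  end.

Lemma fact_rel_inj f k f' k' : fact_rel f k = fact_rel f' k' -> f = f' /\ k = k'.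
Proof. by move=> [] /cpair_inj[/code_murec_inj -> ->]. Qed.

(** The justified facts, written as tries over distinct atoms, form an environment of the right type
    in which the formula holds. *)
Lemma input_expr_undefined n m f :
  mu_eval f [:: n; m] 1 ->
  ~ well_defined content concat (input_expr n m (FAccepts f), input_assignment f).
Proof.
move=> /justified_complete[D [Df JD]] H.
(* [B] exceeds every number in the facts; [B] distinct atoms then stand for the numbers below it. *)
have [B HB] : exists B, forall h t r, (h, t, r) \in D -> all (fun v => v < B) (r :: t).
  exists (\max_(d <- D) \max_(v <- d.2 :: d.1.2) v).+1 => h t r din.
  apply/allP => v vin; rewrite ltnS.
  apply: leq_trans (leq_bigmax_seq (h, t, r) din isT).
  exact: (leq_bigmax_seq v vin isT).
have [l [l_uniq sz_l]] := uniq_atoms B.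
have [a0 _] := atom_infinite fset0.
pose L := fact_tries l a0 D.
pose R j := has_path (trie (L j)).
have B0 : 0 < size l by rewrite sz_l; have /andP[+ _] := HB _ _ _ Df; case: (B).
have R_lt i j : i < size l -> j < size l ->
    R 1 [:: nth a0 l i; nth a0 l j] = (i < j).
  move=> li lj; rewrite /R has_path_trie; apply/hasP/idP => [[u]|ij].
    move=> /allpairsPdep[a [b [al]]].
    rewrite mem_filter => /andP[ab bl ->].
    (* All words of this relation have length 2, so a prefix of length 2 is the whole word. *)
    move=> /prefix_same_size/(_ erefl)[Ea Eb]; move: ab.
    by rewrite -Ea -Eb !index_uniq.
  exists [:: nth a0 l i; nth a0 l j]; last exact: prefix_refl.
  apply/allpairsPdep; exists (nth a0 l i), (nth a0 l j).
  by split=> //; rewrite ?mem_filter !mem_nth // !index_uniq ?ij.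
have factE h t r : model_fact a0 l R h t r <-> (h, t, r) \in D.
  have LE : L (fact_rel h (size t)) = [seq map (nth a0 l) (d.2 :: d.1.2)
      | d <- D & fact_rel d.1.1 (size d.1.2) == fact_rel h (size t)] by [].
  rewrite /model_fact /R has_path_trie LE; split=> [[bd]|din].
    move=> /hasP[u /mapP[[[h' t'] r']]]; rewrite mem_filter /= => /andP[/eqP].
    move=> /fact_rel_inj[-> szt] din -> /prefix_same_size.
    rewrite /= !size_map szt => /(_ erefl) E.
    have bd' := HB _ _ _ din; rewrite -sz_l in bd'.
    have inj (u1 u2 : seq nat) : all (fun v => v < size l) u1 ->
        all (fun v => v < size l) u2 ->
        map (nth a0 l) u1 = map (nth a0 l) u2 -> u1 = u2.
      have idxK u0 : all (fun v => v < size l) u0 ->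
          map (index^~ l) (map (nth a0 l) u0) = u0.
        move=> /allP b0; rewrite -map_comp -[RHS]map_id; apply/eq_in_map => v /b0 lv.
        exact: index_uniq.
      by move=> b1 b2 E'; rewrite -(idxK u1) // E' idxK.
    by case: (inj (r :: t) (r' :: t') bd bd' E) => -> ->.
  split; first by rewrite sz_l; apply: HB din.
  apply/hasP; exists (map (nth a0 l) (r :: t)); last exact: prefix_refl.
  by apply/mapP; exists (h, t, r); rewrite // mem_filter eqxx.
pose e := input_expr n m (FAccepts f).
(* Relation [j] sits at variable 2j + 1, whose half rounds down to [j]. *)
pose s : env atom := [fmap y : fv e => trie (L (val y)./2)].
have fnd_s j : rel_var j \in fv e -> s.[? rel_var j]%fmap = Some (trie (L j)).
  move=> jin; rewrite in_fnd ffunE /= /rel_var.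
  by congr (Some (trie (L _))); lia.
have sG : env_in s (input_assignment f).
  split; first exact: fv_input_expr_const.
  move=> y v T; rewrite fnd_input_assignment; case: ifP => // yin + [<-].
  rewrite (fv_input_expr_const 0 0 n m) in yin.
  have [j Ey] := fv_input_expr_rel yin; rewrite Ey in yin *; rewrite fnd_s // => -[<-].
  apply: trie_typed => u; rewrite /input_depth; case: j {Ey yin} => [|[|j]].
  - by move=> /mapP[a _ ->] /=; lia.
  - by move=> /allpairsPdep[a [b [_ _ ->]]] /=; lia.
  - move=> /mapP[[[h t] r]]; rewrite mem_filter => /andP[_ /JD[szt _]] ->.
    by rewrite /= size_map in szt *; lia.
have [v] := H s sG; rewrite (eval_input_expr n m a0 sG) ifT //.
have d0 : rel_var 0 \in fv e by rewrite fv_input_expr rel_var_fv uses_rel_FInput.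
(* The root labels of the trie of relation 0 are exactly the atoms of [l]. *)
rewrite (@eq_sat_dom _ _ l); last first.
  move=> a; rewrite /env_dom fnd_s //; apply/idP/idP => [/mapP[i iin ->]|al].
    have := has_path_trie (L 0) (item_label i) [::].
    rewrite /= => E; have : has (prefix [:: item_label i]) (L 0).
      by rewrite -E; apply/hasP; exists i; rewrite ?eqxx.
    by move=> /hasP[u /mapP[b bl ->] /prefix_same_size/(_ erefl)[->]].
  have : has_path (trie (L 0)) [:: a].
    by rewrite has_path_trie; apply/hasP; exists [:: a];
      [apply: map_f|apply: prefix_refl].
  by move=> /hasP[i iin]; rewrite andbT => /eqP <-; apply: map_f.
rewrite (@eq_sat_rel _ _ (env_rel s) R) //; last first.
- by move=> j ju t; rewrite /env_rel fnd_s // fv_input_expr rel_var_fv.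
- by move=> j; rewrite /env_rel; case: fndP.
apply: (FInput_complete (a0 := a0)) => //; first exact/factE.
move=> h t r /factE/JD[_]; apply: justified_mono => h' t' r'.
by move=> Hin; apply/factE.
Qed.

End Reduction.

Theorem corollary1 (atom : countType)
    (atom_infinite : forall A : {fset atom}, exists a : atom, a \notin A)
    (atom_re : recursively_enumerable
                 (fun n : nat => exists a : atom, atom_code a = n))
    (content : atom -> {fset node atom} -> atom) (concat : {fset atom} -> atom)
    (content_computable : computable_content content)
    (concat_computable : computable_concat concat) :
  ~ well_definedness_decidable perx_empty content concat /\
  ~ well_definedness_decidable (fun _ : expr => True) content concat.
Proof.
have perx_undecidable : ~ well_definedness_decidable perx_empty content concat.
  move=> [f Hf].
  (* The contexts do not mention [g], so [g] can be defined before the codes [n] and [m] that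
     describe its own instance. *)
  pose g := MuComp f [:: instance_code_mu outer_context (step_context 0)
    inner_context (step_context 2)].
  pose n := code_expr (compile (FAccepts g)).
  pose m := code_assignment (input_assignment g).
  pose p := (input_expr n m (FAccepts g), input_assignment g).
  have codeE : mu_eval (instance_code_mu outer_context (step_context 0)
      inner_context (step_context 2)) [:: n; m] (code_instance p).
    rewrite /code_instance code_input_expr; exact: eval_instance_code.
  have gE : mu_eval g [:: n; m] 1 <-> mu_eval f [:: code_instance p] 1.
    by split; [apply: eval_comp1_inv|apply: eval_comp1].
  have [|Hyes Hno] := Hf p.
    split; first exact: (perx_compile (FInput n m (FAccepts g))).
    exact: (fv_input_expr_const 0 0 n m).
  (* If [p] were well-defined, [f] would answer 1, so [g] would accept and [p] would be
     ill-defined. *)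
  have not_wd : ~ well_defined content concat p.
    by move=> wd; apply: (input_expr_undefined atom_infinite) (wd); apply/gE/Hyes.
  (* But then [f] answers 0, so by determinism [g] does not accept, and [p] is well-defined after
     all. *)
  apply: (not_wd); apply: input_expr_defined => // /gE H1.
  by have := mu_eval_det H1 (Hno not_wd).
(* A procedure for all RX expressions would in particular be correct on the fragment. *)
split=> // -[f Hf]; apply: perx_undecidable; exists f => p [_ dp].
exact: Hf.
Qed.
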